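(* Let $\mathbb K$ be a field of characteristic $0$ and let $\mathcal A\subset\mathbb P^2_{\mathbb K}$ be a line arrangement of rank $3$ consisting of $s$ lines, defined by linear forms $\ell_1,\ldots,\ell_s\in R:=\mathbb K[x,y,z]$ with $\gcd(\ell_i,\ell_j)=1$ for $i\ne j$. Let $I:=I_{s-2}(\mathcal A)$ be the ideal generated by all $f_{i,j}:=\frac{\ell_1\cdots\ell_s}{\ell_i\ell_j}$, $1\le i<j\le s$, and let $\partial(I)$ be the defining ideal of the special fiber of $I$ with respect to the generators $f_{i,j}$. Then $\partial(I)$ is generated by the elements of types (I), (III) and (IV).
   Context: Rank $3$ means that $\ell_1,\ldots,\ell_s$ span a $3$-dimensional space. Presentation ideal and special fiber: let $T:=R[t_{i,j} : 1\le i<j\le s]$, bigraded over $\mathbb K$ by $\deg x=\deg y=\deg z=(1,0)$, $\deg t_{i,j}=(0,1)$. Let $\mathcal I$ be the kernel of the $R$-algebra homomorphism $T\to R[It]$, $t_{i,j}\mapsto f_{i,j}t$, onto the Rees algebra $R[It]\subset R[t]$ of $I$. The ideal $\mathcal I$ is bihomogeneous, and $\partial(I):=\langle \mathcal I_{(0,-)}\rangle$ is the ideal generated by the elements of $\mathcal I$ of bidegrees $(0,v)$, $v\ge 0$, i.e. the elements of $\mathcal I$ involving only the variables $t_{i,j}$; it is the homogeneous defining ideal of the special fiber $R[It]\otimes_R R/\langle x,y,z\rangle$. We use the convention $t_{j,i}=t_{i,j}$. Type (I): for each circuit (minimal dependent set) $\{i_1,i_2,i_3\}$, $1\le i_1<i_2<i_3\le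 s$, of the matroid of $\mathcal A$, with dependency $c_{i_1}\ell_{i_1}+c_{i_2}\ell_{i_2}+c_{i_3}\ell_{i_3}=0$, the element $$L_{i_1,i_2,i_3}:=c_{i_1}t_{i_2,i_3}+c_{i_2}t_{i_1,i_3}+c_{i_3}t_{i_1,i_2}.$$ Type (III): if $s\ge 4$, for all $1\le a<b<c<d\le s$, the elements $$Q^1_{a,b,c,d}:=t_{a,b}t_{c,d}-t_{a,c}t_{b,d},\qquad Q^2_{a,b,c,d}:=t_{a,b}t_{c,d}-t_{a,d}t_{b,c}.$$ Type (IV): for all $1\le j_1<j_2<j_3<j_4\le s$ (the set $\{j_1,j_2,j_3,j_4\}$ is always dependent, but not necessarily a circuit) and every nontrivial linear dependency $d_1\ell_{j_1}+d_2\ell_{j_2}+d_3\ell_{j_3}+d_4\ell_{j_4}=0$ with $d_i\in\mathbb K$ (some of the $d_i$ are allowed to be zero), the elements $$\begin{aligned} P^1&:=d_1t_{j_1,j_2}t_{j_3,j_4}+d_2t_{j_1,j_3}t_{j_1,j_4}+d_3t_{j_1,j_2}t_{j_1,j_4} +d_4t_{j_1,j_2}t_{j_1,j_3},\\ P^2&:=d_1t_{j_2,j_3}t_{j_2,j_4}+d_2t_{j_1,j_2}t_{j_3,j_4}+d_3t_{j_1,j_2}t_{j_2,j_4} +d_4t_{j_1,j_2}t_{j_2,j_3},\\ P^3&:=d_1t_{j_2,j_3}t_{j_3,j_4}+d_2t_{j_1,j_3}t_{j_3,j_4}+d_3t_{j_1,j_2}t_{j_3,j_4}+d_4t_{j_1,j_3}t_{j_2,j_3},\\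 P^4&:=d_1t_{j_2,j_4}t_{j_3,j_4}+d_2t_{j_1,j_4}t_{j_3,j_4}+d_3t_{j_1,j_4}t_{j_2,j_4}+d_4t_{j_1,j_2}t_{j_3,j_4},\\ R^k&:=d_1t_{j_2,j_3}t_{j_4,k}+d_2t_{j_1,j_3}t_{j_4,k}+d_3t_{j_1,j_2}t_{j_4,k}+d_4t_{j_1,j_2}t_{j_3,k},\quad k\in\{1,\ldots,s\}\setminus\{j_1,j_2,j_3,j_4\}. \end{aligned}$$ *)

(* Defs.v *)
From mathcomp Require Import all_boot all_order all_algebra.
From mathcomp Require Export mpoly.

Set Implicit Arguments.
Unset Strict Implicit.
Unset Printing Implicit Defensive.

Import GRing.Theory.
Local Open Scope ring_scope.

Definition ideal_generated (A : comNzRingType) (G : A -> Prop) (x : A) : Prop :=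
  exists (n : nat) (a g : 'I_n -> A),
    (forall i, G (g i)) /\ x = \sum_(i < n) a i * g i.

(* gcd (p, q) = 1: every common divisor is a unit *)
Definition gcd_is_1 (A : comUnitRingType) (p q : A) : Prop :=
  forall d a b : A, p = d * a -> q = d * b -> d \is a GRing.unit.

(* [dhomog 3 K 1] is the K-vector space of linear forms in K[x, y, z]; it
   coerces to [{mpoly K[3]}] and has a canonical [vectType] structure. *)
Notation linear_form K := (dhomog 3 K 1).

Definition line_arrangement (K : fieldType) (s : nat)
    (l : 'I_s -> linear_form K) : Prop :=
  (forall i, l i != 0) /\
  (forall i j, i != j -> gcd_is_1 (l i : {mpoly K[3]}) (l j : {mpoly K[3]})).

Definition arrangement_rank (K : fieldType) (s : nat)
    (l : 'I_s -> linear_form K) : nat :=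
  \dim <<codom l>>%VS.

Definition dependent (K : fieldType) (s : nat) (l : 'I_s -> linear_form K)
    (S : {set 'I_s}) : bool :=
  ~~ free (image l S).

Definition circuit (K : fieldType) (s : nat) (l : 'I_s -> linear_form K)
    (S : {set 'I_s}) : bool :=
  minset (dependent l) S.

(* The index set {(i, j) : i < j} of the generators f_(i,j) and of the
   variables t_(i,j), enumerated so as to index an [mpoly]. *)
Definition pair_lt (s : nat) := {p : 'I_s * 'I_s | (p.1 < p.2)%N}.
Definition npairs (s : nat) : nat := #|{: pair_lt s}|.
Definition pair_of (s : nat) (k : 'I_(npairs s)) : 'I_s * 'I_s :=
  val (enum_val k : pair_lt s).

(* [fgen l i j] is l_1 ... l_s / (l_i l_j) for i != j, see [fgenE]. *)
Definition fgen (K : fieldType) (s : nat) (l : 'I_s -> linear_form K)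
    (i j : 'I_s) : {mpoly K[3]} :=
  \prod_(k < s | (k != i) && (k != j)) (l k : {mpoly K[3]}).

Lemma fgenE (K : fieldType) (s : nat) (l : 'I_s -> linear_form K)
    (i j : 'I_s) : i != j ->
  fgen l i j * ((l i : {mpoly K[3]}) * (l j : {mpoly K[3]})) =
  \prod_(k < s) (l k : {mpoly K[3]}).
Proof.
move=> ne_ij; rewrite [RHS](bigD1 i) //= (bigD1 j) /= 1?eq_sym //.
by rewrite [LHS]mulrC -mulrA.
Qed.

(* T = R[t_(i,j) : i < j] with R = K[x, y, z]; the bigrading is given by the
   degree in x, y, z of the coefficients and the degree in the t_(i,j). *)
Notation Tring K s := {mpoly {mpoly K[3]}[npairs s]}.

Definition bihomog (K : fieldType) (s u v : nat) (F : Tring K s) : Prop :=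
  F \is v.-homog /\ forall m, F@_m \is u.-homog.

(* The R-algebra morphism T -> R[t], t_(i,j) |-> f_(i,j) t, whose image is
   the Rees algebra R[It] of the ideal I generated by the f_(i,j). *)
Definition rees_map (K : fieldType) (s : nat) (l : 'I_s -> linear_form K)
    (F : Tring K s) : {poly {mpoly K[3]}} :=
  mmap (@polyC {mpoly K[3]})
    (fun k => (fgen l (pair_of k).1 (pair_of k).2)%:P * 'X) F.

Definition presentation_ideal (K : fieldType) (s : nat)
    (l : 'I_s -> linear_form K) (F : Tring K s) : Prop :=
  rees_map l F = 0.

Definition special_fiber_ideal (K : fieldType) (s : nat)
    (l : 'I_s -> linear_form K) : Tring K s -> Prop :=
  ideal_generated
    (fun F => presentation_ideal l F /\ exists v, bihomog 0 v F).

(* The variable t_(i,j), with t_(j,i) = t_(i,j); junk value 0 for i = j. *)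
Definition tvar (K : fieldType) (s : nat) (i j : 'I_s) : Tring K s :=
  if insub (if (i < j)%N then (i, j) else (j, i)) is Some p
  then 'X_(enum_rank (p : pair_lt s)) else 0.

(* Scalar multiplication by K on T. *)
Definition kscale (K : fieldType) (s : nat) (c : K) (F : Tring K s) :
  Tring K s := c%:MP_[3] *: F.

Section Types.
Variables (K : fieldType) (s : nat) (l : 'I_s -> linear_form K).

Local Notation t i j := (@tvar K s i j).
Local Notation "c *t F" := (@kscale K s c F) (at level 40).

Inductive type_I : Tring K s -> Prop :=
| TypeI (i1 i2 i3 : 'I_s) (c1 c2 c3 : K) of
    (i1 < i2 < i3)%N & circuit l [set i1; i2; i3] &
    (c1, c2, c3) != (0, 0, 0) &
    c1 *: l i1 + c2 *: l i2 + c3 *: l i3 = 0 :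
  type_I (c1 *t t i2 i3 + c2 *t t i1 i3 + c3 *t t i1 i2).

Inductive type_III : Tring K s -> Prop :=
| TypeIII_Q1 (a b c d : 'I_s) of (a < b)%N & (b < c)%N & (c < d)%N :
  type_III (t a b * t c d - t a c * t b d)
| TypeIII_Q2 (a b c d : 'I_s) of (a < b)%N & (b < c)%N & (c < d)%N :
  type_III (t a b * t c d - t a d * t b c).

Definition dependency4 (j1 j2 j3 j4 : 'I_s) (d1 d2 d3 d4 : K) : Prop :=
  [/\ (j1 < j2)%N, (j2 < j3)%N, (j3 < j4)%N,
      (d1, d2, d3, d4) != (0, 0, 0, 0) &
      d1 *: l j1 + d2 *: l j2 + d3 *: l j3 + d4 *: l j4 = 0].

Inductive type_IV : Tring K s -> Prop :=
| TypeIV_P1 j1 j2 j3 j4 d1 d2 d3 d4 of dependency4 j1 j2 j3 j4 d1 d2 d3 d4 :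
  type_IV (d1 *t (t j1 j2 * t j3 j4) + d2 *t (t j1 j3 * t j1 j4)
         + d3 *t (t j1 j2 * t j1 j4) + d4 *t (t j1 j2 * t j1 j3))
| TypeIV_P2 j1 j2 j3 j4 d1 d2 d3 d4 of dependency4 j1 j2 j3 j4 d1 d2 d3 d4 :
  type_IV (d1 *t (t j2 j3 * t j2 j4) + d2 *t (t j1 j2 * t j3 j4)
         + d3 *t (t j1 j2 * t j2 j4) + d4 *t (t j1 j2 * t j2 j3))
| TypeIV_P3 j1 j2 j3 j4 d1 d2 d3 d4 of dependency4 j1 j2 j3 j4 d1 d2 d3 d4 :
  type_IV (d1 *t (t j2 j3 * t j3 j4) + d2 *t (t j1 j3 * t j3 j4)
         + d3 *t (t j1 j2 * t j3 j4) + d4 *t (t j1 j3 * t j2 j3))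
| TypeIV_P4 j1 j2 j3 j4 d1 d2 d3 d4 of dependency4 j1 j2 j3 j4 d1 d2 d3 d4 :
  type_IV (d1 *t (t j2 j4 * t j3 j4) + d2 *t (t j1 j4 * t j3 j4)
         + d3 *t (t j1 j4 * t j2 j4) + d4 *t (t j1 j2 * t j3 j4))
| TypeIV_R j1 j2 j3 j4 d1 d2 d3 d4 k of dependency4 j1 j2 j3 j4 d1 d2 d3 d4 &
    k \notin [:: j1; j2; j3; j4] :
  type_IV (d1 *t (t j2 j3 * t j4 k) + d2 *t (t j1 j3 * t j4 k)
         + d3 *t (t j1 j2 * t j4 k) + d4 *t (t j1 j2 * t j3 k)).

End Types.

(* Main.v *)
From HB Require Import structures.
Require Import Defs.
From mathcomp Require Import all_boot all_order all_algebra ring zify.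

Set Implicit Arguments.
Unset Strict Implicit.
Unset Printing Implicit Defensive.

Import GRing.Theory.
Local Open Scope ring_scope.

(** Write [y_i = 1 / l_i]. Up to the common factor [(l_1 ... l_s) ^ d], a monomial of
    degree [d] in the [t_(i,j)] evaluates to the monomial [y ^ v], where [v] is the
    degree sequence of the loopless multigraph whose edges are the factors
    [t_(i,j)]. So the special fiber is the algebra generated by the squarefree
    quadratic monomials in reciprocals of linear forms, and each listed element
    vanishes there: type (III) compares two monomials with the same degree
    sequence, while types (I) and (IV) are a linear dependency of the [l_i] times a
    monomial in the [y_i]. For the converse fix a degree [d].

    The exchange quadrics (III) identify any two monomials with the same degree
    sequence ([tprod_cong]): a prescribed edge can be produced by exchanges as soon
    as the degree sequence allows it ([produce_edge]). There remain the classes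
    [tmon d v] of the vectors [v] with [|v| = 2 d] and all [v_i <= d].

    The linear relations known among these classes are best stated for a vector [w]
    with [|w| = 2 d + 1] and all [w_i <= d]: whenever [\sum_i e_i l_i = 0] with [e]
    supported where [w] is positive, [\sum_i e_i y ^ (w - U_i)] lies in the ideal
    ([relation_ideal]). Types (I) and (IV) yield this for dependencies of few lines.
    In a space of dimension 3 every dependency is a combination of dependencies of
    four lines, all of them containing a line [q] chosen in advance; taking [q] with
    [w_q] maximal makes the cofactor a monomial of the right kind.

    That nothing else is needed is shown by comparing leading terms. Let [n] be a
    line, and [Q] a pencil of lines through a point of [n]. Order the [v] by [v_n],
    then by [\sum_(j in Q) v_j]; up to sign these are the orders of [y ^ v] along [n]
    and then at that point. Two monomials with the same values [k > 0] and [a > 0]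
    of these two numbers are proportional modulo the ideal and smaller ones: their
    exponents differ by exchanges of a unit between two lines [j], [j'] both in [Q]
    or both outside, and [l_j'] is a combination of [l_n], some [l_i] with [i] in [Q],
    and [l_j]; in the corresponding relation the first two terms are smaller
    ([top_stratum_proportional]). On the other hand a suitable curve reads off the
    leading coefficient ([leading_coef_eq0]). So an equation has zero leading
    coefficient and is congruent to one with smaller monomials. Lowering [a] to [0]
    removes the lines of [Q] from the monomials with [v_n = k]; doing so for all the
    pencils leaves only [y_n ^ k], of degree [k <= d < 2 d], hence nothing. This
    lowers [k] to [0], and then the line [n] has disappeared
    ([eval_inj_supported]). *)

(** * Congruence modulo a generated ideal *)

Section Ideals.
Variables (A : comNzRingType) (G : A -> Prop).
Implicit Types x y z : A.

Lemma ideal0 : ideal_generated G 0.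
Proof. by exists 0%N, (fun=> 0), (fun=> 0); split=> [[]//|]; rewrite big_ord0. Qed.

Lemma ideal_gen x : G x -> ideal_generated G x.
Proof. by move=> Gx; exists 1%N, (fun=> 1), (fun=> x); rewrite big_ord1 mul1r. Qed.

Lemma idealD x y :
  ideal_generated G x -> ideal_generated G y -> ideal_generated G (x + y).
Proof.
move=> [n [a [g [Gg ->]]]] [m [b [h [Gh ->]]]].
exists (n + m)%N, (fun i => match split i with inl j => a j | inr j => b j end),
  (fun i => match split i with inl j => g j | inr j => h j end).
split=> [i|]; first by case: split.
rewrite big_split_ord /=; congr (_ + _); apply: eq_bigr => i _.
  by rewrite -[lshift _ _]/(unsplit (inl i)) unsplitK.
by rewrite -[rshift _ _]/(unsplit (inr i)) unsplitK.
Qed.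

Lemma idealMl x y : ideal_generated G y -> ideal_generated G (x * y).
Proof.
move=> [n [a [g [Gg ->]]]]; exists n, (fun i => x * a i), g; split=> //.
by rewrite mulr_sumr; apply: eq_bigr => i _; rewrite mulrA.
Qed.

Lemma ideal_sum (I : Type) (r : seq I) (P : pred I) (F : I -> A) :
  (forall i, P i -> ideal_generated G (F i)) ->
  ideal_generated G (\sum_(i <- r | P i) F i).
Proof. by move=> GF; apply: big_ind => //; [apply: ideal0 | apply: idealD]. Qed.

Lemma ideal_sub (H : A -> Prop) x :
  (forall y, H y -> ideal_generated G y) ->
  ideal_generated H x -> ideal_generated G x.
Proof.
move=> GH [n [a [h [Hh ->]]]]; apply: ideal_sum => i _.
by apply: idealMl; apply: GH.
Qed.

Definition cong x y := ideal_generated G (x - y).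

Lemma cong_refl x : cong x x.
Proof. by rewrite /cong subrr; apply: ideal0. Qed.

Lemma cong_sym x y : cong x y -> cong y x.
Proof. by move=> /(idealMl (-1)); rewrite /cong mulN1r opprB. Qed.

Lemma cong_trans y x z : cong x y -> cong y z -> cong x z.
Proof.
by move=> xy yz; rewrite /cong -(subrKA y); apply: idealD.
Qed.

Lemma congD x y x' y' : cong x y -> cong x' y' -> cong (x + x') (y + y').
Proof. by move=> xy xy'; rewrite /cong opprD addrACA; apply: idealD. Qed.

Lemma congMl z x y : cong x y -> cong (z * x) (z * y).
Proof. by move=> xy; rewrite /cong -mulrBr; apply: idealMl. Qed.

Lemma cong_ideal x y : cong x y -> ideal_generated G y -> ideal_generated G x.
Proof. by move=> xy Gy; rewrite -(subrK y x); apply: idealD. Qed.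

End Ideals.

(** * The variables and their values *)

Section Variables.
Variables (K : fieldType) (s : nat) (l : 'I_s -> linear_form K).

Local Notation t i j := (@tvar K s i j).

Lemma tvarC i j : t i j = t j i.
Proof.
rewrite /tvar; case: (ltngtP i j) => // /val_inj ->; by [].
Qed.

Lemma tvar_pair_of k : t (pair_of k).1 (pair_of k).2 = 'X_k.
Proof.
have lt : ((pair_of k).1 < (pair_of k).2)%N := valP (enum_val k).
by rewrite /tvar lt -surjective_pairing /pair_of valK enum_valK.
Qed.

Lemma bihomog_tvar i j : bihomog 0 1 (t i j).
Proof.
rewrite /tvar; case: insub => [p|]; split.
- by rewrite dhomogX /= mdeg1.
- move=> m; rewrite mcoeffX; case: (_ == m); first exact: dhomog1.
  exact: dhomog0.
- exact: dhomog0.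
- by move=> m; rewrite mcoeff0; apply: dhomog0.
Qed.

HB.instance Definition _ := GRing.RMorphism.copy (rees_map l)
  (mmap (@polyC {mpoly K[3]})
    (fun k : 'I_(npairs s) => (fgen l (pair_of k).1 (pair_of k).2)%:P * 'X)).

Lemma rees_kscale c F : rees_map l (kscale c F) = c%:MP%:P * rees_map l F.
Proof. by rewrite /kscale /rees_map mmapZ. Qed.

Lemma fgenC i j : fgen l i j = fgen l j i.
Proof. by apply: eq_bigl => k; rewrite andbC. Qed.

Lemma rees_tvar i j : i != j -> rees_map l (t i j) = (fgen l i j)%:P * 'X.
Proof.
have main (a b : 'I_s) : (a < b)%N -> rees_map l (t a b) = (fgen l a b)%:P * 'X.
  move=> ab; rewrite /tvar ab insubT //= /rees_map mmapX mmap1U.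
  by rewrite /pair_of enum_rankK.
by rewrite neq_ltn => /orP[/main //|/main]; rewrite tvarC fgenC.
Qed.

End Variables.

(* Unification must not unfold these into sparse polynomials. *)
Local Opaque tvar kscale.

(** * Multigraphs and the exchange quadrics *)

Section Multigraphs.
Variables (K : fieldType) (s : nat) (l : 'I_s -> linear_form K).

Local Notation t i j := (@tvar K s i j).
Local Notation gens :=
  (fun G : Tring K s => type_I l G \/ type_III G \/ type_IV l G).
Local Notation "x === y" := (cong gens x y) (at level 70).

Lemma quad_sorted (a b c d : 'I_s) : (a < b)%N -> (b < c)%N -> (c < d)%N ->
  [/\ t a b * t c d === t a c * t b d, t a b * t c d === t a d * t b c &
      t a c * t b d === t a d * t b c].
Proof.
move=> ab bc cd.
have Q1 : t a b * t c d === t a c * t b d.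
  by apply: ideal_gen; right; left; apply: TypeIII_Q1.
have Q2 : t a b * t c d === t a d * t b c.
  by apply: ideal_gen; right; left; apply: TypeIII_Q2.
by split; [exact: Q1 | exact: Q2 | exact: cong_trans (cong_sym Q1) Q2].
Qed.

Lemma quad_swap (a b c d : 'I_s) : uniq [:: a; b; c; d] ->
  t a b * t c d === t a c * t b d.
Proof.
(* The equation is preserved, up to its orientation, by (a b)(c d), (a c)(b d) and
   (b c); the first two bring the smallest index to the front. *)
have main : forall a b c d : 'I_s, uniq [:: a; b; c; d] ->
    (a < b)%N -> (a < c)%N -> (a < d)%N -> t a b * t c d === t a c * t b d.
  move=> {}a {}b {}c {}d.
  wlog bc : b c / (b < c)%N => [hw|].
    case: (ltngtP b c) => [|cb|/val_inj->]; first exact: hw; last first.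
      by rewrite /= !inE eqxx /= !andbF.
    move=> u ab ac ad; apply: cong_sym; apply: hw => //.
    by move: u; rewrite /= !inE (eq_sym c b) !negb_or; do !case: (_ == _).
  move=> u ab ac ad.
  have [cd|dc|/val_inj cd] := ltngtP c d; last by move: u; rewrite cd /= !inE eqxx !andbF.
    by case: (quad_sorted ab bc cd).
  have [bd|db|/val_inj bd] := ltngtP b d; last by move: u; rewrite bd /= !inE eqxx !orbT !andbF.
    by rewrite (tvarC K c d); case: (quad_sorted ab bd dc).
  by rewrite (tvarC K c d) (tvarC K b d); case: (quad_sorted ad db bc).
move=> u; have u' := u; move: u' => /=; rewrite !inE !negb_or.
case/and4P=> /and3P[nab nac nad] /andP[nbc nbd] ncd _.
have lt (x y : 'I_s) : x != y -> (x < y)%N \/ (y < x)%N.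
  by rewrite neq_ltn => /orP.
have mainp (x y z w : 'I_s) : uniq [:: x; y; z; w] ->
  (x < y)%N && (x < z)%N && (x < w)%N -> t x y * t z w === t x z * t y w.
  by move=> uu /andP[/andP[]]; apply: main.
have [A|A] := boolP ((a < b)%N && (a < c)%N && (a < d)%N); first exact: mainp.
have [B|B] := boolP ((b < a)%N && (b < d)%N && (b < c)%N).
  rewrite [t a b]tvarC [t c d]tvarC [t a c * _]mulrC; apply: mainp => //.
  by rewrite /= !inE !negb_or eq_sym nab nbd nbc nad nac eq_sym ncd.
have [C|C] := boolP ((c < d)%N && (c < a)%N && (c < b)%N).
  rewrite [t a b * _]mulrC [t a c]tvarC [t b d]tvarC; apply: mainp => //.
  by rewrite /= !inE !negb_or ncd (eq_sym c) nac (eq_sym c) nbc (eq_sym d) nad (eq_sym d) nbd nab.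
rewrite [t a b * _]mulrC [t c d]tvarC [t a b]tvarC [t a c * _]mulrC [t b d]tvarC [t a c]tvarC.
apply: mainp.
  rewrite /= !inE !negb_or (eq_sym d) ncd (eq_sym d) nbd (eq_sym d) nad.
  by rewrite (eq_sym c) nbc (eq_sym c) nac (eq_sym b) nab.
by move: (lt _ _ nab) (lt _ _ nac) (lt _ _ nad) (lt _ _ nbc) (lt _ _ nbd) (lt _ _ ncd) A B C; lia.
Qed.

Definition tprod (es : seq ('I_s * 'I_s)) : Tring K s :=
  \prod_(e <- es) t e.1 e.2.

Definition loopless (es : seq ('I_s * 'I_s)) := all (fun e => e.1 != e.2) es.

Definition edeg (es : seq ('I_s * 'I_s)) : 'X_{1..s} :=
  (\sum_(e <- es) (U_(e.1) + U_(e.2)))%MM.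

Lemma edeg_nil : edeg [::] = 0%MM.
Proof. by rewrite /edeg big_nil. Qed.

Lemma edeg_cons e es : edeg (e :: es) = (U_(e.1) + U_(e.2) + edeg es)%MM.
Proof. by rewrite /edeg big_cons. Qed.

Lemma tprod_nil : tprod [::] = 1.
Proof. by rewrite /tprod big_nil. Qed.

Lemma tprod_cons e es : tprod (e :: es) = t e.1 e.2 * tprod es.
Proof. by rewrite /tprod big_cons. Qed.

Lemma edeg_cat es1 es2 : edeg (es1 ++ es2) = (edeg es1 + edeg es2)%MM.
Proof. by rewrite /edeg big_cat. Qed.

Lemma tprod_cat es1 es2 : tprod (es1 ++ es2) = tprod es1 * tprod es2.
Proof. by rewrite /tprod big_cat. Qed.

Lemma mdeg_edeg es : mdeg (edeg es) = (2 * size es)%N.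
Proof.
elim: es => [|e es IH]; first by rewrite edeg_nil mdeg0.
by rewrite edeg_cons !mdegD !mdeg1 IH /=; lia.
Qed.

Lemma edeg_le es i : loopless es -> (edeg es i <= size es)%N.
Proof.
elim: es => [|e es IH] /=; first by rewrite edeg_nil mnm0E.
case/andP=> ne /IH; rewrite edeg_cons !mnmDE !mnm1E.
case: (eqVneq e.1 i) => [e1|_]; case: (eqVneq e.2 i) => [e2|_] /=; try lia.
by rewrite e1 e2 eqxx in ne.
Qed.

(** A list of ordered pairs carries an order and orientations that its monomial
    forgets; this relation retains only what the monomial sees. *)
Definition removal i b es es' :=
  [/\ loopless es', i != b, size es = (size es').+1,
      edeg es = (U_(i) + U_(b) + edeg es')%MM &
      tprod es = t i b * tprod es'].

Lemma removal_head e es : loopless (e :: es) -> removal e.1 e.2 (e :: es) es.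
Proof. by case/andP=> ne le; split; rewrite ?edeg_cons ?tprod_cons. Qed.

Lemma removal_sym i b es es' : removal i b es es' -> removal b i es es'.
Proof.
case=> le ne sz deg tp; split=> //; first by rewrite eq_sym.
  by rewrite deg [(U_(i) + _)%MM]addmC.
by rewrite tp tvarC.
Qed.

Lemma removal_cons i b e es es' : e.1 != e.2 -> removal i b es es' ->
  removal i b (e :: es) (e :: es').
Proof.
move=> ne [le nib sz de te]; split=> //=; first by rewrite ne.
- by rewrite sz.
- by rewrite !edeg_cons de; apply/mnmP=> k; rewrite !mnmDE; clear; lia.
- by rewrite !tprod_cons te mulrCA.
Qed.

Lemma removal_at i es : loopless es -> (0 < edeg es i)%N ->
  exists b es', removal i b es es'.
Proof.
elim: es => [|e es IH]; first by rewrite edeg_nil mnm0E.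
move=> lees; have := lees => /andP[ne le].
rewrite edeg_cons !mnmDE !mnm1E.
case: (eqVneq e.1 i) => [<- _|_].
  by exists e.2, es; apply: removal_head.
case: (eqVneq e.2 i) => [<- _|_] /=.
  by exists e.1, es; apply/removal_sym/removal_head.
by case/IH=> // b [es' R]; exists b, (e :: es'); apply: removal_cons.
Qed.

Lemma removal_avoiding a es : loopless es -> (edeg es a < size es)%N ->
  exists c d es', [/\ c != a, d != a & removal c d es es'].
Proof.
elim: es => [|e es IH]; first by rewrite edeg_nil mnm0E.
move=> lees; have := lees => /andP[ne le].
rewrite edeg_cons !mnmDE !mnm1E /=.
case: (eqVneq e.1 a) => [_|ne1].
  rewrite add1n => lt; case: IH => // [|c [d [es' [ca da R]]]]; first by lia.
  by exists c, d, (e :: es'); split=> //; apply: removal_cons.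
case: (eqVneq e.2 a) => [_|ne2].
  rewrite add0n add1n ltnS => lt; case: IH => // c [d [es' [ca da R]]].
  by exists c, d, (e :: es'); split=> //; apply: removal_cons.
by move=> _; exists e.1, e.2, es; split=> //; apply: removal_head.
Qed.

(** Modulo the exchange quadrics, every edge which the degree sequence allows
    can be produced: two edges [i - a], [j - b] are exchanged for [i - j],
    [a - b]; when [a = b] is the only neighbour of both [i] and [j], the bound on
    the degree of [a] yields an edge that avoids [a] and serves as a buffer. *)
Lemma produce_edge i j es : loopless es -> i != j ->
  (0 < edeg es i)%N -> (0 < edeg es j)%N ->
  (forall a, a != i -> a != j -> (edeg es a < size es)%N) ->
  exists es', [/\ loopless es', size es = (size es').+1,
    edeg es = (U_(i) + U_(j) + edeg es')%MM & tprod es === t i j * tprod es'].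
Proof.
move=> les nij i_gt0 j_gt0 bound.
have [a [es1 [les1 nia sz1 deg1 tp1]]] := removal_at les i_gt0.
have [eaj|naj] := eqVneq a j.
  by exists es1; rewrite -eaj; split=> //; rewrite tp1; apply: cong_refl.
have j1_gt0 : (0 < edeg es1 j)%N.
  by move: j_gt0; rewrite deg1 !mnmDE !mnm1E (negPf nij) (negPf naj).
have [b [es2 [les2 njb sz2 deg2 tp2]]] := removal_at les1 j1_gt0.
have [ebi|nbi] := eqVneq b i.
  exists ((i, a) :: es2); split=> /=; first by rewrite nia.
  - by rewrite sz1 sz2.
  - by rewrite edeg_cons deg1 deg2 ebi /=; apply/mnmP=> k; rewrite !mnmDE; clear; lia.
  - rewrite tp1 tp2 tprod_cons ebi (tvarC K j i) /= mulrCA.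
    exact: cong_refl.
have [eab|nab] := eqVneq a b; last first.
  exists ((a, b) :: es2); split=> /=; first by rewrite nab.
  - by rewrite sz1 sz2.
  - by rewrite edeg_cons deg1 deg2 /=; apply/mnmP=> k; rewrite !mnmDE; clear; lia.
  - rewrite tp1 tp2 tprod_cons /= !mulrA ![_ * tprod es2]mulrC.
    apply/congMl/quad_swap; rewrite /= !inE !negb_or nia nij eq_sym nbi.
    by rewrite naj nab njb.
subst b; have a_lt : (edeg es2 a < size es2)%N.
  have := bound a; rewrite eq_sym nia naj => /(_ isT isT).
  rewrite deg1 deg2 !mnmDE !mnm1E eqxx (negPf nia) (eq_sym j) (negPf naj).
  by rewrite sz1 sz2; lia.
have [c [d [es3 [nca nda R]]]] := removal_avoiding les2 a_lt.
(* an edge at i or j that avoids a already does the job *)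
have at_i d' : d' != a -> removal i d' es2 es3 -> exists es',
    [/\ loopless es', size es = (size es').+1,
    edeg es = (U_(i) + U_(j) + edeg es')%MM & tprod es === t i j * tprod es'].
  move=> nda' [les3 nid sz3 deg3 tp3].
  have [ejd|njd] := eqVneq j d'.
    exists ((i, a) :: (j, a) :: es3); split=> /=.
    - by rewrite nia njb.
    - by rewrite sz1 sz2 sz3.
    - rewrite !edeg_cons deg1 deg2 deg3 -ejd /=.
      by apply/mnmP=> k; rewrite !mnmDE; clear; lia.
    - rewrite tp1 tp2 tp3 -ejd !tprod_cons /=.
      have -> : t i a * (t j a * (t i j * tprod es3)) =
        t i j * (t i a * (t j a * tprod es3)) by ring.
      exact: cong_refl.
  exists ((i, a) :: (d', a) :: es3); split=> /=.
  - by rewrite nia nda'.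
  - by rewrite sz1 sz2 sz3.
  - by rewrite !edeg_cons deg1 deg2 deg3 /=; apply/mnmP=> k; rewrite !mnmDE; clear; lia.
  - rewrite tp1 tp2 tp3 !tprod_cons /=.
    have -> : t i a * (t j a * (t i d' * tprod es3)) =
      (t i a * tprod es3) * (t i d' * t j a) by ring.
    have -> : t i j * (t i a * (t d' a * tprod es3)) =
      (t i a * tprod es3) * (t i j * t d' a) by ring.
    apply/congMl/quad_swap; rewrite /= !inE !negb_or nid nij nia.
    by rewrite eq_sym njd nda' njb.
have at_j d' : d' != a -> removal j d' es2 es3 -> exists es',
    [/\ loopless es', size es = (size es').+1,
    edeg es = (U_(i) + U_(j) + edeg es')%MM & tprod es === t i j * tprod es'].
  move=> nda' RR; have [les3 njd sz3 deg3 tp3] := RR.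
  have [eid|nid] := eqVneq i d'.
    by apply: (at_i j); [rewrite eq_sym | rewrite eid; apply: removal_sym].
  exists ((j, a) :: (d', a) :: es3); split=> /=.
  - by rewrite njb nda'.
  - by rewrite sz1 sz2 sz3.
  - by rewrite !edeg_cons deg1 deg2 deg3 /=; apply/mnmP=> k; rewrite !mnmDE; clear; lia.
  - rewrite tp1 tp2 tp3 !tprod_cons /=.
    have -> : t i a * (t j a * (t j d' * tprod es3)) =
      (t j a * tprod es3) * (t j d' * t i a) by ring.
    have -> : t i j * (t j a * (t d' a * tprod es3)) =
      (t j a * tprod es3) * (t j i * t d' a) by rewrite (tvarC K j i); ring.
    apply/congMl/quad_swap; rewrite /= !inE !negb_or njd eq_sym nij njb.
    by rewrite eq_sym nid nda' nia.
have [eci|nci] := eqVneq c i; first by apply: (at_i d) => //; rewrite -eci.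
have [edi|ndi] := eqVneq d i.
  by apply: (at_i c) => //; rewrite -edi; apply: removal_sym.
have [ecj|ncj] := eqVneq c j; first by apply: (at_j d) => //; rewrite -ecj.
have [edj|ndj] := eqVneq d j.
  by apply: (at_j c) => //; rewrite -edj; apply: removal_sym.
have [les3 ncd sz3 deg3 tp3] := R.
exists ((a, c) :: (d, a) :: es3); split=> /=.
- by rewrite eq_sym nca nda.
- by rewrite sz1 sz2 sz3.
- by rewrite !edeg_cons deg1 deg2 deg3 /=; apply/mnmP=> k; rewrite !mnmDE; clear; lia.
rewrite tp1 tp2 tp3 !tprod_cons /=.
apply: (@cong_trans _ _ ((t j a * tprod es3) * (t i c * t a d))).
  have -> : t i a * (t j a * (t c d * tprod es3)) =
    (t j a * tprod es3) * (t i a * t c d) by ring.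
  apply/congMl/quad_swap; rewrite /= !inE !negb_or nia (eq_sym i) nci.
  by rewrite (eq_sym i) ndi (eq_sym a) nca (eq_sym a) nda ncd.
have -> : (t j a * tprod es3) * (t i c * t a d) =
  (t a d * tprod es3) * (t i c * t j a) by ring.
have -> : t i j * (t a c * (t d a * tprod es3)) =
  (t a d * tprod es3) * (t i j * t c a).
  by rewrite (tvarC K d a) (tvarC K a c); ring.
apply/congMl/quad_swap; rewrite /= !inE !negb_or (eq_sym i) nci nij nia.
by rewrite ncj nca njb.
Qed.

(** The exchange quadrics generate the relations among the squarefree quadratic
    monomials: a product of the [t_(i,j)] is determined by its degree
    sequence. *)
Lemma tprod_cong es es' : loopless es -> loopless es' -> edeg es = edeg es' ->
  tprod es === tprod es'.
Proof.
elim: es es' => [|[i j] es IH] es' les les' deq.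
  case: es' les' deq => [_ _|e es' _ /(congr1 (@mdeg _))]; first exact: cong_refl.
  by rewrite edeg_nil edeg_cons !mdegD !mdeg1 mdeg0.
have szeq : size es' = (size es).+1.
  have := congr1 (@mdeg _) deq; rewrite !mdeg_edeg /=; lia.
move: (les) => /andP[/= nij les1].
have dE k : edeg es' k = ((i == k) + (j == k) + edeg es k)%N.
  by rewrite -deq edeg_cons !mnmDE !mnm1E.
case: (@produce_edge i j es') => // [||a nai naj|es2 [les2 sz2 deg2 c2]].
- by rewrite dE eqxx.
- by rewrite dE eqxx; lia.
- rewrite dE eq_sym (negPf nai) eq_sym (negPf naj) szeq ltnS.
  exact: edeg_le.
apply: cong_sym; apply: cong_trans c2 _; rewrite tprod_cons /=.
apply: congMl; apply: cong_sym; apply: IH => //.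
apply/mnmP=> k; have := congr1 (fun m : 'X_{1..s} => m k) deg2.
rewrite dE !mnmDE !mnm1E; lia.
Qed.
End Multigraphs.

Local Opaque tprod.

(** * Linear forms in three variables *)

Section LinearForms.
Variable K : fieldType.
Implicit Types p q : linear_form K.

Definition lrow p : 'rV[K]_3 := \row_a (p : {mpoly K[3]})@_U_(a).

Lemma lrow_is_linear : linear lrow.
Proof. by move=> a p q; apply/rowP=> i; rewrite !mxE mcoeffD mcoeffZ. Qed.

HB.instance Definition _ :=
  GRing.isLinear.Build K (linear_form K) 'rV[K]_3 _ lrow lrow_is_linear.

(** A linear form is determined by its row of coefficients, which makes the row
    space calculus available for dependencies. *)
Lemma linear_formE p : p = \sum_a lrow p 0 a *: 'X_a :> {mpoly K[3]}.
Proof.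
apply/mpolyP=> m; rewrite raddf_sum /=.
have [/mdeg1P[i /eqP->]|m1] := boolP (mdeg m == 1%N); last first.
  rewrite (dhomog_nemf_coeff (dhomog_is_dhomog p) m1) big1 // => a _.
  rewrite mcoeffZ mcoeffX; have [E|_] := eqVneq U_(a)%MM m.
    by rewrite -E mdeg1 in m1.
  by rewrite mulr0.
rewrite (bigD1 i) //= mcoeffZ mcoeffXU eqxx mulr1 mxE big1 ?addr0 // => a ai.
by rewrite mcoeffZ mcoeffXU (negPf ai) mulr0.
Qed.

Lemma lrow_inj : injective lrow.
Proof.
by move=> p q pq; apply: val_inj; rewrite /= linear_formE [RHS]linear_formE pq.
Qed.

Lemma linear_form_nonunit p : p != 0 -> (p : {mpoly K[3]}) \isn't a GRing.unit.
Proof.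
move=> p0; apply/negP=> p_unit.
have /andP[/eqP pE _] : mpoly_unit (p : {mpoly K[3]}) := p_unit.
have p0' : (p : {mpoly K[3]}) != 0 by apply: contra_neq p0 => p0; apply: val_inj.
have h0 : (p : {mpoly K[3]}) \is 0.-homog.
  by rewrite pE -alg_mpolyC; apply/dhomogZ/dhomog1.
have h1 : (p : {mpoly K[3]}) \is 1.-homog by apply: dhomog_is_dhomog.
by have := dhomog_uniq p0' h0 h1.
Qed.

End LinearForms.

Section Dependencies.
Variables (K : fieldType) (s : nat) (l : 'I_s -> linear_form K).
Hypothesis arrA : line_arrangement l.

Local Notation L i := (lrow (l i)).

(** Proportional forms would have one of them as a common divisor, and a nonzero
    linear form is not a unit. *)
Lemma lines_indep i j a b : i != j -> a *: l i + b *: l j = 0 ->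
  a = 0 /\ b = 0.
Proof.
case: arrA => l0 gcd1 nij ab0.
have [a0|a0] := eqVneq a 0.
  move/eqP: ab0; rewrite a0 scale0r add0r scaler_eq0 (negPf (l0 j)) orbF.
  by move=> /eqP.
case/negP: (linear_form_nonunit (l0 j)).
apply: (gcd1 i j nij (l j) (- (a^-1 * b))%:MP 1); last by rewrite mulr1.
rewrite mulrC mul_mpolyC.
have -> : l i = - (a^-1 * b) *: l j.
  rewrite scaleNr -scalerA -scalerN; apply: canRL (scalerK a0) _.
  by apply/eqP; rewrite -addr_eq0; apply/eqP.
by [].
Qed.

Lemma lrow_neq0 i : L i != 0.
Proof.
case: arrA => l0 _; apply: contraNneq (l0 i) => Li0.
by apply/eqP/lrow_inj; rewrite Li0 linear0.
Qed.

Lemma rank_pair i j : i != j -> \rank (L i + L j)%MS = 2%N.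
Proof.
move=> nij; apply/eqP; rewrite eqn_leq; apply/andP; split.
  by apply: leq_trans (mxrank_adds_leqif _ _) _; rewrite !rank_rV !lrow_neq0.
have : (L i < L i + L j)%MS.
  rewrite ltmxE addsmxSl /=; apply/negP=> sub.
  have /sub_rVP[c Lj] : (L j <= L i)%MS.
    by apply: submx_trans sub; apply: addsmxSr.
  have : c *: l i + (-1) *: l j = 0.
    by apply: lrow_inj; rewrite linearD !linearZ linear0 /= -Lj scaleN1r subrr.
  by case/(lines_indep nij) => _ /eqP; rewrite oppr_eq0 oner_eq0.
by rewrite ltmxErank => /andP[_]; rewrite rank_rV lrow_neq0.
Qed.

Lemma span_triple i j k m (A : 'M[K]_(m, 3)) :
  i != j -> ~~ (L k <= L i + L j)%MS -> (A <= L i + L j + L k)%MS.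
Proof.
move=> nij k_out; apply: submx_full; rewrite /row_full eqn_leq rank_leq_col /=.
have : (L i + L j < L i + L j + L k)%MS.
  rewrite ltmxE addsmxSl /=; apply: contra k_out; apply: submx_trans.
  exact: addsmxSr.
by rewrite ltmxErank (rank_pair nij) => /andP[].
Qed.

Lemma span_pair i j k : i != j -> k != i -> (L k <= L i + L j)%MS ->
  (L j <= L i + L k)%MS.
Proof.
move=> nij nki k_in.
have : (L i + L k <= L i + L j)%MS by rewrite addsmx_sub addsmxSl.
move/mxrank_leqif_eq => le; have := le; rewrite rank_pair 1?eq_sym //.
rewrite rank_pair // => -[_]; rewrite eqxx => /esym/andP[_].
by apply: submx_trans; apply: addsmxSr.
Qed.

Lemma span_pair_coefs i j m : (L m <= L i + L j)%MS ->
  exists a b, l m = a *: l i + b *: l j.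
Proof.
case/sub_addsmxP=> -[u v] /= E.
have /sub_rVP[a aE] := submxMl u (L i); have /sub_rVP[b bE] := submxMl v (L j).
by exists a, b; apply: lrow_inj; rewrite linearD !linearZ /= -aE -bE.
Qed.

Lemma span_triple_coefs i j k m : (L m <= L i + L j + L k)%MS ->
  exists a b c, l m = a *: l i + b *: l j + c *: l k.
Proof.
case/sub_addsmxP=> -[u v] /= E.
have /sub_addsmxP[[u1 u2] /= uE] := submxMl u (L i + L j)%MS.
have /sub_rVP[a aE] := submxMl u1 (L i); have /sub_rVP[b bE] := submxMl u2 (L j).
have /sub_rVP[c cE] := submxMl v (L k).
exists a, b, c; apply: lrow_inj.
by rewrite !linearD !linearZ /= -aE -bE -cE -uE.
Qed.

Lemma free_lines (S : {set 'I_s}) :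
  ~~ dependent l S <->
  forall e : 'I_s -> K, \sum_(i in S) e i *: l i = 0 ->
    forall i, i \in S -> e i = 0.
Proof.
rewrite /dependent negbK; have sz := size_image l (mem S).
pose X := Tuple (introT eqP sz); rewrite -[image _ _]/(tval X).
have sumE (e : 'I_s -> K) :
    \sum_(i in S) e i *: l i = \sum_(k < #|S|) e (enum_val k) *: X`_k.
  rewrite big_enum_val /=; apply: eq_bigr => k _; congr (_ *: _).
  by rewrite /image_mem (nth_map (enum_val k)) -?cardE // -enum_val_nth.
split=> [/freeP fX e e0 i iS | fS].
  have := fX (fun k => e (enum_val k)); rewrite -sumE e0.
  by move=> /(_ erefl (enum_rank_in iS i)); rewrite enum_rankK_in.
apply/freeP=> k k0 i; have iS := enum_valP i.
have := fS (fun x => k (enum_rank_in iS x)); rewrite sumE.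
rewrite (eq_bigr (fun j => k j *: X`_j)) => [|j _]; last by rewrite enum_valK_in.
by move=> /(_ k0 _ iS); rewrite enum_valK_in.
Qed.

Lemma free_sub_pair i j (B : {set 'I_s}) : i != j -> B \subset [set i; j] ->
  ~~ dependent l B.
Proof.
move=> nij /subsetP subB; apply/free_lines => e e0 m mB.
pose e' x := if x \in B then e x else 0.
have sumB : \sum_(x in B) e x *: l x = \sum_(x in [set i; j]) e' x *: l x.
  rewrite big_mkcond [RHS]big_mkcond; apply: eq_bigr => x _; rewrite /e'.
  by have [/subB ->|_] := boolP (x \in B); rewrite ?scale0r ?if_same.
have [] := @lines_indep i j (e' i) (e' j) nij.
  rewrite -[RHS]e0 sumB big_setU1 ?inE //=.
  by rewrite big_set1.
rewrite /e'; move: (subB m mB) (mB); rewrite !inE => /orP[]/eqP-> ->; done.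
Qed.

(** Two lines are always independent, so a dependent triple is minimal. *)
Lemma circuit_triple (i1 i2 i3 : 'I_s) c1 c2 c3 :
  (i1 < i2)%N -> (i2 < i3)%N -> (c1, c2, c3) != (0, 0, 0) ->
  c1 *: l i1 + c2 *: l i2 + c3 *: l i3 = 0 -> circuit l [set i1; i2; i3].
Proof.
move=> lt12 lt23 c_neq0 dep.
have n12 : i1 != i2 by rewrite neq_ltn lt12.
have n23 : i2 != i3 by rewrite neq_ltn lt23.
have n13 : i1 != i3 by rewrite neq_ltn (ltn_trans lt12 lt23).
have sum3 (e : 'I_s -> K) : \sum_(i in [set i1; i2; i3]) e i *: l i =
    e i1 *: l i1 + e i2 *: l i2 + e i3 *: l i3.
  rewrite -setUA !big_setU1 /= ?big_set1 ?inE ?negb_or ?n12 ?n13 //=.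
  by rewrite addrA.
apply/minsetP; split=> [|B depB subB].
  have [//|/free_lines fr] := boolP (dependent l [set i1; i2; i3]).
  pose e i := if i == i1 then c1 else if i == i2 then c2 else c3.
  have [E1 E2 E3] : [/\ e i1 = c1, e i2 = c2 & e i3 = c3].
    rewrite /e !eqxx ![i2 == _]eq_sym ![i3 == _]eq_sym.
    by rewrite (negPf n12) (negPf n13) (negPf n23).
  have := fr e; rewrite sum3 E1 E2 E3 => /(_ dep) e0.
  by case/eqP: c_neq0; rewrite -E1 -E2 -E3 !e0 // !inE eqxx ?orbT.
apply/eqP; rewrite eqEsubset subB /=; apply/subsetP=> m mS.
apply: contraTT depB => mB.
have sub_pair i j : [set i1; i2; i3] :\ m \subset [set i; j] ->
    B \subset [set i; j].
  by apply: subset_trans; rewrite subsetD1 subB.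
move: mS sub_pair; rewrite !inE -orbA => /or3P[]/eqP-> sub_pair.
- apply: (free_sub_pair n23); apply: sub_pair; apply/subsetP=> x.
  by rewrite !inE -orbA => /andP[/negPf->].
- apply: (free_sub_pair n13); apply: sub_pair; apply/subsetP=> x.
  by rewrite !inE => /andP[/negPf->]; rewrite orbF.
- apply: (free_sub_pair n12); apply: sub_pair; apply/subsetP=> x.
  by rewrite !inE => /andP[/negPf->]; rewrite orbF.
Qed.
End Dependencies.

(** * Monomials with a given degree sequence *)

Section DegreeSequences.
Variable s : nat.
Implicit Types v w : 'X_{1..s}.

Lemma mdeg_ge_uniq v (r : seq 'I_s) : uniq r -> (\sum_(x <- r) v x <= mdeg v)%N.
Proof.
move=> ur; rewrite mdegE (big_uniq _ ur) /= [leqRHS](bigID (mem r)) /=.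
exact: leq_addr.
Qed.

Lemma mdegB1 v i : (0 < v i)%N -> mdeg (v - U_(i))%MM = (mdeg v).-1.
Proof.
move=> vi; have {2}-> : v = (v - U_(i) + U_(i))%MM by rewrite submK // lep1mP -lt0n.
by rewrite mdegD mdeg1 addn1.
Qed.

Lemma exists_max v : (0 < s)%N -> exists i, forall j, (v j <= v i)%N.
Proof.
move=> s_gt0; pose i0 := Ordinal s_gt0.
by have [i _ imax] := @arg_maxnP _ i0 predT v isT; exists i => j; apply: imax.
Qed.

Lemma mdeg_gt0 v : (0 < mdeg v)%N -> (0 < s)%N.
Proof. by rewrite mdegE; case: s v => // v; rewrite big_ord0. Qed.

Lemma mdeg_sub1 v i : (mdeg v = v i + \sum_(j | j != i) v j)%N.
Proof. by rewrite mdegE (bigD1 i). Qed.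

(** By [valid_edeg] and [exists_multigraph] these are exactly the degree sequences
    of the loopless multigraphs with [d] edges. *)
Definition valid d v := (mdeg v == 2 * d)%N && [forall i, v i <= d]%N.

Lemma validP d v :
  reflect (mdeg v = (2 * d)%N /\ forall i, (v i <= d)%N) (valid d v).
Proof.
apply: (iffP andP) => [[/eqP dv /forallP lev]|[dv lev]]; first by split.
by split; [apply/eqP | apply/forallP].
Qed.

Lemma valid_edeg es : loopless es -> valid (size es) (edeg es).
Proof.
by move=> les; apply/validP; split=> [|i]; [apply: mdeg_edeg | apply: edeg_le].
Qed.

(** Greedy construction: after an edge between the two vertices of largest degree,
    a third vertex cannot exceed the new bound [d - 1], since three vertices of
    degree [d] would give a total of [3 d > 2 d]. *)
Lemma exists_multigraph d v : valid d v ->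
  exists es : seq ('I_s * 'I_s), [/\ loopless es, size es = d & edeg es = v].
Proof.
elim: d v => [|d IH] v /validP[dv lev].
  exists [::]; split=> //; apply/esym/eqP.
  by rewrite edeg_nil -mdeg_eq0 dv.
have s_gt0 : (0 < s)%N by apply: (@mdeg_gt0 v); rewrite dv.
have [i imax] := exists_max v s_gt0.
have [j0 j0i vj0] : exists2 j, j != i & (0 < v j)%N.
  have : (0 < \sum_(j | j != i) v j)%N.
    by have := mdeg_sub1 v i; have := lev i; rewrite dv; lia.
  rewrite lt0n sum_nat_eq0 negb_forall => /existsP[j].
  by rewrite negb_imply -lt0n => /andP[]; exists j.
have [j ji jmax] := @arg_maxnP _ j0 (fun j => j != i) v j0i.
have vj : (0 < v j)%N := leq_trans vj0 (jmax j0 j0i).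
have vi : (0 < v i)%N := leq_trans vj (imax j).
have vE : v = (U_(i) + U_(j) + (v - U_(i) - U_(j)))%MM.
  apply/mnmP=> a; rewrite !mnmDE !mnmBE !mnm1E.
  case: (eqVneq i a) => [<-|nia]; first by rewrite (negPf ji); lia.
  by case: (eqVneq j a) => [<-|nja]; lia.
case: (IH (v - U_(i) - U_(j))%MM) => [|es [les <- des]].
  apply/validP; split.
    by have := congr1 (@mdeg _) vE; rewrite dv !mdegD !mdeg1; lia.
  move=> a; rewrite !mnmBE !mnm1E.
  have [<-|nia] := eqVneq i a; first by have := lev i; lia.
  have [<-|nja] := eqVneq j a; first by have := lev j; lia.
  have aj : (v a <= v j)%N by apply: jmax; rewrite eq_sym.
  have := @mdeg_ge_uniq v [:: i; j; a].
  rewrite /= !inE !negb_or eq_sym ji nia nja => /(_ isT).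
  by rewrite !big_cons big_nil dv; have := imax j; have := lev a; lia.
exists ((i, j) :: es); split=> //=; first by rewrite eq_sym ji.
by rewrite edeg_cons des /= -vE.
Qed.

End DegreeSequences.

Section Monomials.
Variables (K : fieldType) (s : nat) (l : 'I_s -> linear_form K).

Local Notation t i j := (@tvar K s i j).
Local Notation gens :=
  (fun G : Tring K s => type_I l G \/ type_III G \/ type_IV l G).
Local Notation J := (ideal_generated gens).
Local Notation "x === y" := (cong gens x y) (at level 70).
Local Notation "c *t F" := (@kscale K s c F) (at level 40).

(** A chosen multigraph represents its class modulo the exchange quadrics, so that
    [tmon d v] plays the part of the monomial [\prod_i y_i ^ v_i] in
    [y_i = 1 / l_i]. *)
Definition tmon d (v : 'X_{1..s}) : Tring K s :=
  if [pick es : d.-tuple ('I_s * 'I_s) | loopless es && (edeg es == v)] is Some es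
  then tprod K es else 0.

Lemma tmonP d v : valid d v -> exists es,
  [/\ loopless es, size es = d, edeg es = v & tmon d v = tprod K es].
Proof.
move=> /exists_multigraph[es [les sz deg]]; rewrite /tmon.
case: pickP => [es' /andP[les' /eqP deg']|/(_ (Tuple (introT eqP sz)))].
  by exists es'; rewrite size_tuple.
by rewrite /= les deg eqxx.
Qed.

Lemma tprod_tmon es : loopless es -> tprod K es === tmon (size es) (edeg es).
Proof.
move=> les; have [es' [les' _ deg' ->]] := tmonP (valid_edeg les).
exact: tprod_cong.
Qed.

Lemma tmon_mulr es d v : loopless es -> valid d v ->
  tprod K es * tmon d v === tmon (size es + d) (edeg es + v).
Proof.
move=> les /tmonP[es' [les' <- <- ->]].
rewrite -tprod_cat -size_cat -edeg_cat; apply: tprod_tmon.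
by rewrite /loopless all_cat; apply/andP.
Qed.

Local Opaque tmon.

Lemma tmon_edge i j d v : i != j -> valid d v ->
  t i j * tmon d v === tmon d.+1 (U_(i) + U_(j) + v).
Proof.
move=> nij vv; have := @tmon_mulr [:: (i, j)] d v; rewrite /= nij => /(_ isT vv).
rewrite edeg_cons edeg_nil addm0 tprod_cons tprod_nil.
by rewrite mulr1.
Qed.

Lemma tmon_edges i j i' j' d v : i != j -> i' != j' -> valid d v ->
  (t i j * t i' j') * tmon d v === tmon d.+2 (U_(i) + U_(j) + (U_(i') + U_(j')) + v).
Proof.
move=> nij nij' vv; have := @tmon_mulr [:: (i, j); (i', j')] d v.
rewrite /= nij nij' => /(_ isT vv).
rewrite !edeg_cons edeg_nil addm0 !tprod_cons tprod_nil.
by rewrite mulr1.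
Qed.

Lemma kscaleE c (F : Tring K s) : c *t F = c%:MP%:MP * F.
Proof. by rewrite mul_mpolyC. Qed.

Lemma kscale_ideal c F : J F -> J (c *t F).
Proof. by rewrite kscaleE; apply: idealMl. Qed.

Lemma kscale_cong c F G : F === G -> c *t F === c *t G.
Proof. by rewrite !kscaleE; apply: congMl. Qed.

Lemma kscaleDl c c' F : (c + c') *t F = c *t F + c' *t F.
Proof. by rewrite !kscaleE !mpolyCD mulrDl. Qed.

Lemma kscaleA c c' F : c *t (c' *t F) = (c * c') *t F.
Proof. by rewrite !kscaleE !mpolyCM mulrA. Qed.

Lemma kscale0 F : 0 *t F = 0.
Proof. by rewrite kscaleE !mpolyC0 mul0r. Qed.

Lemma kscale1 F : 1 *t F = F.
Proof. by rewrite kscaleE !mpolyC1 mul1r. Qed.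

Lemma kscale_sumr (I : Type) (r : seq I) c (F : I -> Tring K s) :
  c *t (\sum_(i <- r) F i) = \sum_(i <- r) c *t F i.
Proof. by rewrite kscaleE mulr_sumr; apply: eq_bigr => i _; rewrite kscaleE. Qed.

Lemma kscale_mull c F G : (c *t F) * G = c *t (F * G).
Proof. by rewrite !kscaleE mulrA. Qed.

End Monomials.

Local Opaque tmon.

(** * Relations attached to linear dependencies *)

Section Relations.
Variables (K : fieldType) (s : nat) (l : 'I_s -> linear_form K).
Hypothesis arrA : line_arrangement l.

Local Notation t i j := (@tvar K s i j).
Local Notation gens :=
  (fun G : Tring K s => type_I l G \/ type_III G \/ type_IV l G).
Local Notation J := (ideal_generated gens).
Local Notation "x === y" := (cong gens x y) (at level 70).
Local Notation "c *t F" := (@kscale K s c F) (at level 40).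

Lemma sorted_enum (C : {set 'I_s}) :
  sorted (fun x y : 'I_s => (x < y)%N) (enum C).
Proof.
rewrite /enum_mem; apply: sorted_filter => [y x z|]; first exact: ltn_trans.
by rewrite -enumT; have := iota_ltn_sorted 0 s; rewrite -val_enum_ord sorted_map.
Qed.

Lemma kscale_sum3 c1 c2 c3 (A1 A2 A3 F : Tring K s) :
  (c1 *t A1 + c2 *t A2 + c3 *t A3) * F
  = c1 *t (A1 * F) + c2 *t (A2 * F) + c3 *t (A3 * F).
Proof. by rewrite mulrDl mulrDl !kscale_mull. Qed.

Lemma kscale_sum4 c1 c2 c3 c4 (A1 A2 A3 A4 F : Tring K s) :
  (c1 *t A1 + c2 *t A2 + c3 *t A3 + c4 *t A4) * F
  = c1 *t (A1 * F) + c2 *t (A2 * F) + c3 *t (A3 * F) + c4 *t (A4 * F).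
Proof. by rewrite mulrDl kscale_sum3 kscale_mull. Qed.

(** A type (I) element is the dependency times [y_j1 y_j2 y_j3]; the
    factor [tmon d v] carries it to any degree. *)
Lemma type_I_relation d v (j1 j2 j3 : 'I_s) c1 c2 c3 :
  (j1 < j2)%N -> (j2 < j3)%N -> valid d v ->
  c1 *: l j1 + c2 *: l j2 + c3 *: l j3 = 0 ->
  let w := (U_(j1) + U_(j2) + U_(j3) + v)%MM in
  J (c1 *t tmon K d.+1 (w - U_(j1)) + c2 *t tmon K d.+1 (w - U_(j2))
     + c3 *t tmon K d.+1 (w - U_(j3))).
Proof.
move=> lt12 lt23 vv dep w.
have n12 : j1 != j2 by rewrite neq_ltn lt12.
have n23 : j2 != j3 by rewrite neq_ltn lt23.
have n13 : j1 != j3 by rewrite neq_ltn (ltn_trans lt12 lt23).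
have [[-> -> ->]|c0] := eqVneq (c1, c2, c3) (0, 0, 0).
  by rewrite !kscale0 !addr0; apply: ideal0.
have T j a b : a != b -> (U_(a) + U_(b) + v + U_(j))%MM = w ->
    tmon K d.+1 (w - U_(j)) === t a b * tmon K d v.
  move=> nab <-; rewrite addmK; apply: cong_sym.
  exact: tmon_edge.
apply: (@cong_ideal _ _ _
  ((c1 *t t j2 j3 + c2 *t t j1 j3 + c3 *t t j1 j2) * tmon K d v)).
  rewrite kscale_sum3.
  by apply: congD; [apply: congD|]; apply: kscale_cong; apply: T => //;
     rewrite /w; apply/mnmP=> x; rewrite !mnmDE; clear; lia.
rewrite mulrC; apply/idealMl/ideal_gen; left; apply: TypeI => //.
  by rewrite lt12 lt23.
exact: (circuit_triple arrA lt12 lt23 c0).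
Qed.

(** The five shapes of quadric attached to a linear dependency of four lines are
    the same relation, multiplied by [y_k] for the five possible positions of [k]
    relative to these lines. *)
Lemma type_IV_relation d v (j1 j2 j3 j4 k : 'I_s) d1 d2 d3 d4 :
  (j1 < j2)%N -> (j2 < j3)%N -> (j3 < j4)%N -> valid d v ->
  d1 *: l j1 + d2 *: l j2 + d3 *: l j3 + d4 *: l j4 = 0 ->
  let w := (U_(j1) + U_(j2) + U_(j3) + U_(j4) + U_(k) + v)%MM in
  J (d1 *t tmon K d.+2 (w - U_(j1)) + d2 *t tmon K d.+2 (w - U_(j2))
     + d3 *t tmon K d.+2 (w - U_(j3)) + d4 *t tmon K d.+2 (w - U_(j4))).
Proof.
move=> lt12 lt23 lt34 vv dep w.
have lt13 := ltn_trans lt12 lt23; have lt24 := ltn_trans lt23 lt34.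
have lt14 := ltn_trans lt12 lt24.
have n12 : j1 != j2 by rewrite neq_ltn lt12.
have n13 : j1 != j3 by rewrite neq_ltn lt13.
have n14 : j1 != j4 by rewrite neq_ltn lt14.
have n23 : j2 != j3 by rewrite neq_ltn lt23.
have n24 : j2 != j4 by rewrite neq_ltn lt24.
have n34 : j3 != j4 by rewrite neq_ltn lt34.
have [[-> -> -> ->]|d0] := eqVneq (d1, d2, d3, d4) (0, 0, 0, 0).
  by rewrite !kscale0 !addr0; apply: ideal0.
have dep4 : dependency4 l j1 j2 j3 j4 d1 d2 d3 d4 by split.
have T j a b a' b' : a != b -> a' != b' ->
    (U_(a) + U_(b) + (U_(a') + U_(b')) + v + U_(j))%MM = w ->
    tmon K d.+2 (w - U_(j)) === (t a b * t a' b') * tmon K d v.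
  move=> nab nab' <-; rewrite addmK; apply: cong_sym.
  exact: tmon_edges.
suff [g [Gg gE]] : exists g, type_IV l g /\
    d1 *t tmon K d.+2 (w - U_(j1)) + d2 *t tmon K d.+2 (w - U_(j2))
    + d3 *t tmon K d.+2 (w - U_(j3)) + d4 *t tmon K d.+2 (w - U_(j4))
    === g * tmon K d v.
  apply: cong_ideal gE _; rewrite mulrC; apply/idealMl/ideal_gen.
  by right; right.
have [k_in|k_out] := boolP (k \in [:: j1; j2; j3; j4]); last first.
  have nk j : j \in [:: j1; j2; j3; j4] -> j != k.
    by move=> jC; apply/eqP=> jk; case/negP: k_out; rewrite -jk.
  eexists; split; first by apply: (TypeIV_R dep4 k_out).
  rewrite kscale_sum4.
  by apply: congD; [apply: congD; [apply: congD|]|]; apply: kscale_cong;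
     apply: T; rewrite ?nk ?inE ?eqxx ?orbT //;
     rewrite /w; apply/mnmP=> x; rewrite !mnmDE; clear; lia.
move: k_in; rewrite !inE => /or4P[]/eqP k_eq; subst k; eexists.
- split; first by apply: (TypeIV_P1 dep4).
  rewrite kscale_sum4.
  by apply: congD; [apply: congD; [apply: congD|]|]; apply: kscale_cong;
     apply: T => //; rewrite /w; apply/mnmP=> x; rewrite !mnmDE; clear; lia.
- split; first by apply: (TypeIV_P2 dep4).
  rewrite kscale_sum4.
  by apply: congD; [apply: congD; [apply: congD|]|]; apply: kscale_cong;
     apply: T => //; rewrite /w; apply/mnmP=> x; rewrite !mnmDE; clear; lia.
- split; first by apply: (TypeIV_P3 dep4).
  rewrite kscale_sum4.
  by apply: congD; [apply: congD; [apply: congD|]|]; apply: kscale_cong;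
     apply: T => //; rewrite /w; apply/mnmP=> x; rewrite !mnmDE; clear; lia.
- split; first by apply: (TypeIV_P4 dep4).
  rewrite kscale_sum4.
  by apply: congD; [apply: congD; [apply: congD|]|]; apply: kscale_cong;
     apply: T => //; rewrite /w; apply/mnmP=> x; rewrite !mnmDE; clear; lia.
Qed.

Definition dependency (e : 'I_s -> K) := \sum_i e i *: l i = 0.

Definition relation d w (e : 'I_s -> K) : Tring K s :=
  \sum_i e i *t tmon K d (w - U_(i)).

Lemma sum_on_set (V : nmodType) (C : {set 'I_s}) (F : 'I_s -> V) :
  (forall i, i \notin C -> F i = 0) -> \sum_i F i = \sum_(i <- enum C) F i.
Proof.
by move=> F0; rewrite big_enum /= (bigID (mem C)) /= [X in _ + X]big1 ?addr0.
Qed.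

(** After division by the four variables of [C], a further factor [y_k] must be
    split off so that the rest is the degree sequence of a multigraph with [d - 2]
    edges. This is where the maximality of [w q] matters: the cofactor could
    otherwise contain [y_i ^ d] for some [i] outside [C], and no choice of [k] would
    bring all the exponents down to [d - 2]. *)
Lemma relation_on_four d w q (C : {set 'I_s}) e :
  mdeg w = (2 * d).+1 -> (forall i, w i <= d)%N -> (forall i, w i <= w q)%N ->
  q \in C -> #|C| = 4 -> (forall i, i \in C -> 0 < w i)%N ->
  (forall i, i \notin C -> e i = 0) -> dependency e -> J (relation d w e).
Proof.
move=> dw lew qmax qC C4 wC eC dep; rewrite /relation.
rewrite (@sum_on_set _ C) => [|i /eC->]; last exact: kscale0.
move: dep; rewrite /dependency (@sum_on_set _ C) => [|i /eC->]; last exact: scale0r.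
have := sorted_enum C; have := enum_uniq C.
have memC i : (i \in C) = (i \in enum C) by rewrite mem_enum.
move: C4; rewrite cardE.
case: (enum C) memC => [|j1 [|j2 [|j3 [|j4 []]]]] //= memC _.
rewrite -/(uniq [:: j1; j2; j3; j4]) => uC /and4P[lt12 lt23 lt34 _].
rewrite !big_cons !big_nil !addr0 !addrA => dep.
have w1 : (0 < w j1)%N by apply: wC; rewrite memC !inE eqxx ?orbT.
have w2 : (0 < w j2)%N by apply: wC; rewrite memC !inE eqxx ?orbT.
have w3 : (0 < w j3)%N by apply: wC; rewrite memC !inE eqxx ?orbT.
have w4 : (0 < w j4)%N by apply: wC; rewrite memC !inE eqxx ?orbT.
have sum4 := @mdeg_ge_uniq _ w [:: j1; j2; j3; j4] uC.
have {}sum4 : (w j1 + w j2 + w j3 + w j4 <= (2 * d).+1)%N.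
  by move: sum4; rewrite !big_cons big_nil dw !addnA addn0.
pose u := (U_(j1) + U_(j2) + U_(j3) + U_(j4))%MM.
have uE x : u x = (x \in C).
  by rewrite memC -(@count_uniq_mem _ _ x uC) /= !mnmDE !mnm1E addn0 !addnA.
have uw : (u <= w)%MM.
  by apply/mnm_lepP=> x; rewrite uE; case: (boolP (x \in C)) => // /wC.
have du : mdeg (w - u)%MM = (2 * d - 3)%N.
  have := congr1 (@mdeg _) (submK uw); rewrite mdegD dw /u !mdegD !mdeg1.
  by clear -sum4 w1 w2 w3 w4; lia.
have [k kmax] := exists_max (w - u)%MM (mdeg_gt0 (leq_ltn_trans (leq0n _) (eq_leq (esym dw)))).
pose v := (w - u - U_(k))%MM.
have d_ge2 : (2 <= d)%N by clear -sum4 w1 w2 w3 w4; lia.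
have wk : (0 < (w - u)%MM k)%N.
  rewrite lt0n; apply/negP=> /eqP k0.
  have : (w - u)%MM = 0%MM.
    by apply/mnmP=> x; apply/eqP; rewrite mnm0E -leqn0 -k0.
  by move/(congr1 (@mdeg _)); rewrite mdeg0 du; clear -d_ge2; lia.
have wE : w = (u + U_(k) + v)%MM.
  rewrite /v; clearbody u; apply/mnmP=> x; have ux := (mnm_lepP uw) x.
  rewrite !mnmDE !mnmBE !mnm1E; move: ux wk; rewrite mnmBE.
  by case: (eqVneq k x) => [->|_]; clear; lia.
have vv : valid (d - 2) v.
  apply/validP; split.
    by rewrite mdegB1 // du; clear -d_ge2; lia.
  have small x : ((w - u)%MM x <= d.-1)%N.
    rewrite mnmBE uE; case: (boolP (x \in C)) => [xC|xC].
      by have := lew x; have := wC x xC; clear; lia.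
    have xq : (w x <= w q)%N by apply: qmax.
    have := @mdeg_ge_uniq _ w [:: x; j1; j2; j3; j4].
    rewrite cons_uniq uC -memC xC !big_cons big_nil dw => /(_ isT).
    move: qC; rewrite memC !inE => /or4P[]/eqP qE; rewrite qE in xq.
    - by have := lew x; clear -xq w1 w2 w3 w4; lia.
    - by have := lew x; clear -xq w1 w2 w3 w4; lia.
    - by have := lew x; clear -xq w1 w2 w3 w4; lia.
    - by have := lew x; clear -xq w1 w2 w3 w4; lia.
  move=> x; rewrite /v mnmBE mnm1E; case: (eqVneq k x) => [<-|nkx].
    by have := small k; clear -d_ge2; lia.
  have := @mdeg_ge_uniq _ (w - u)%MM [:: x; k].
  rewrite /= inE eq_sym nkx => /(_ isT); rewrite !big_cons big_nil du.
  by have := kmax x; clear -d_ge2; lia.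
have := type_IV_relation k lt12 lt23 lt34 vv dep.
rewrite -/u -wE; have -> : (d - 2).+2 = d by clear -d_ge2; lia.
by [].
Qed.
End Relations.

Section GeneralRelations.
Variables (K : fieldType) (s : nat) (l : 'I_s -> linear_form K).
Hypothesis arrA : line_arrangement l.

Local Notation gens :=
  (fun G : Tring K s => type_I l G \/ type_III G \/ type_IV l G).
Local Notation J := (ideal_generated gens).
Local Notation "c *t F" := (@kscale K s c F) (at level 40).
Local Notation L i := (lrow (l i)).

(** Type (IV) needs four lines in the support of [w]. With three of them,
    dividing by the three variables brings all the exponents down to [d - 1] and leaves
    the degree sequence of a multigraph with [d - 1] edges; so type (I) applies. *)
Lemma relation_on_three d w (C : {set 'I_s}) e :
  mdeg w = (2 * d).+1 -> (forall i, w i <= d)%N -> #|C| = 3 ->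
  (forall i, (0 < w i)%N = (i \in C)) ->
  (forall i, i \notin C -> e i = 0) -> dependency l e -> J (relation d w e).
Proof.
move=> dw lew C3 wC eC dep; rewrite /relation.
rewrite (@sum_on_set _ _ C) => [|i /eC->]; last exact: kscale0.
move: dep; rewrite /dependency (@sum_on_set _ _ C) => [|i /eC->]; last exact: scale0r.
have := sorted_enum C; have := enum_uniq C.
have memC i : (i \in C) = (i \in enum C) by rewrite mem_enum.
move: C3; rewrite cardE.
case: (enum C) memC => [|j1 [|j2 [|j3 []]]] //= memC _.
rewrite -/(uniq [:: j1; j2; j3]) => uC /and3P[lt12 lt23 _].
rewrite !big_cons !big_nil !addr0 !addrA => dep.
have w1 : (0 < w j1)%N by rewrite wC memC !inE eqxx ?orbT.
pose u := (U_(j1) + U_(j2) + U_(j3))%MM.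
have uE x : u x = (x \in C).
  by rewrite memC -(@count_uniq_mem _ _ x uC) /= !mnmDE !mnm1E addn0 !addnA.
have uw : (u <= w)%MM.
  by apply/mnm_lepP=> x; rewrite uE -wC; case: (w x).
have wE : w = (u + (w - u))%MM by rewrite addmC submK.
have d_gt0 : (0 < d)%N := leq_trans w1 (lew j1).
have vv : valid d.-1 (w - u)%MM.
  apply/validP; split.
    have := congr1 (@mdeg _) wE; rewrite mdegD dw {1}/u !mdegD !mdeg1.
    by clear -d_gt0; lia.
  by move=> x; rewrite mnmBE uE -wC; have := lew x; case: (w x) => // n; clear; lia.
have := type_I_relation arrA lt12 lt23 vv dep.
by rewrite -/u -wE prednK.
Qed.

Lemma relation_lin d w e e' c :
  relation d w e = relation d w (fun i => e i - c * e' i) + c *t relation d w e'.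
Proof.
rewrite /relation kscale_sumr -big_split /=; apply: eq_bigr => i _.
by rewrite kscaleA -kscaleDl subrK.
Qed.

Lemma support_card d (w : 'X_{1..s}) :
  mdeg w = (2 * d).+1 -> (forall i, w i <= d)%N ->
  (3 <= #|[set i | (0 < w i)%N]|)%N.
Proof.
move=> dw lew; rewrite ltnNge; apply/negP=> S2.
suff : (mdeg w <= #|[set i | 0 < w i]| * d)%N.
  by rewrite dw; move: S2; clear; nia.
rewrite -sum_nat_const mdegE (bigID (mem [set i | (0 < w i)%N])) /=.
rewrite [X in (_ + X)%N]big1 ?addn0; last first.
  by move=> i; rewrite inE lt0n negbK => /eqP.
exact: leq_sum.
Qed.

(** Modulo dependencies of four lines that all contain [q], [a] and [b], every
    dependency is reduced to one supported on [q], [a], [b], where [l q], [l a], [l b]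
    span all the lines involved. *)
Lemma relation_ideal d w e :
  mdeg w = (2 * d).+1 -> (forall i, w i <= d)%N ->
  (forall i, w i = 0%N -> e i = 0) -> dependency l e -> J (relation d w e).
Proof.
move=> dw lew; set S := [set i | (0 < w i)%N].
have eS (f : 'I_s -> K) : (forall i, w i = 0%N -> f i = 0) ->
  forall i, i \notin S -> f i = 0.
  by move=> f0 i; rewrite inE lt0n negbK => /eqP/f0.
have := support_card dw lew; rewrite -/S leq_eqVlt => /orP[/eqP S3|S4].
  move=> e0 dep; apply: (@relation_on_three d w S) => //; last exact: eS.
  by move=> i; rewrite inE.
have [q qmax] := exists_max w (mdeg_gt0 (leq_ltn_trans (leq0n _) (eq_leq (esym dw)))).
have qS : q \in S.
  rewrite inE lt0n; apply/negP=> /eqP q0.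
  have : w = 0%MM by apply/mnmP=> x; apply/eqP; rewrite mnm0E -leqn0 -q0.
  by move/(congr1 (@mdeg _)); rewrite dw mdeg0.
have extra (r : seq 'I_s) : (size r <= 3)%N -> exists2 j, j \in S & j \notin r.
  move=> r3; have : ~~ (S \subset r).
    apply/negP=> /subset_leq_card le; have := leq_trans le (card_size r).
    by move=> {}le; have := leq_ltn_trans (leq_trans le r3) S4; rewrite ltnn.
  by case/subsetPn=> j; exists j.
have [a aS] := @extra [:: q] isT; rewrite inE => naq.
(* The lines q, a, b must span all the lines of S; when q and a already do so, b is
   arbitrary. *)
have [b [bS nb span]] : exists b, [/\ b \in S, b \notin [:: q; a] &
    forall j, j \in S -> (L j <= L q + L a + L b)%MS].
  have [/existsP[b /andP[bS b_out]]|/existsPn in_qa] :=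
      boolP [exists b, (b \in S) && ~~ (L b <= L q + L a)%MS].
    exists b; split=> //; last by move=> j _; apply: span_triple; rewrite 1?eq_sym.
    apply: contraNN b_out; rewrite !inE => /orP[]/eqP->.
      exact: addsmxSl.
    exact: addsmxSr.
  have [b bS nb] := @extra [:: q; a] isT; exists b; split=> // j jS.
  apply: submx_trans (addsmxSl _ _).
  by have := in_qa j; rewrite jS negbK.
have four j : j \in S -> j \notin [:: q; a; b] -> forall f,
    (forall i, i \notin [:: q; a; b; j] -> f i = 0) -> dependency l f ->
    J (relation d w f).
  move=> jS nj f f0 depf.
  apply: (relation_on_four (q := q) (C := [set x in [:: q; a; b; j]])) => //.
  - by rewrite !inE eqxx.
  - rewrite cardsE; apply/card_uniqP; rewrite /= !inE !negb_or.
    move: nj nb; rewrite !inE !negb_or => /and3P[n1 n2 n3] /andP[n4 n5].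
    by rewrite !(eq_sym q) naq n4 n1 !(eq_sym a) n5 n2 eq_sym n3.
  - move=> i; rewrite !inE => /or4P[]/eqP->.
    + by move: qS; rewrite inE.
    + by move: aS; rewrite inE.
    + by move: bS; rewrite inE.
    + by move: jS; rewrite inE.
  - by move=> i; rewrite inE; apply: f0.
pose out (f : 'I_s -> K) := [set x : 'I_s | (f x != 0) && (x \notin [:: q; a; b])].
have [n] := ubnP #|out e|; elim: n e => // n IH e.
rewrite ltnS => le_n e0 dep.
have [out0|[j]] := set_0Vmem (out e).
  have [j jS nj] := @extra [:: q; a; b] isT; apply: (four j) => // i ni.
  apply/eqP; apply: contraTT isT => ei; have : i \in out e.
    rewrite inE ei; apply: contraNN ni; rewrite !inE.
    by case/or3P=> ->; rewrite ?orbT.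
  by rewrite out0 inE.
rewrite inE => /andP[ej nj].
have jS : j \in S by apply: contraNT ej => /(eS _ e0)->.
have [al [be [ga lj]]] := span_triple_coefs (span j jS).
pose f x : K := (x == j)%:R - al *+ (x == q) - be *+ (x == a) - ga *+ (x == b).
have f0 i : i \notin [:: q; a; b; j] -> f i = 0.
  rewrite !inE !negb_or /f => /and4P[/negPf-> /negPf-> /negPf-> /negPf->].
  by rewrite !mulr0n !subr0.
have fj : f j = 1.
  move: nj; rewrite !inE !negb_or /f eqxx => /and3P[/negPf-> /negPf-> /negPf->].
  by rewrite !mulr0n !subr0.
have delta c i : \sum_x (c *+ (x == i)) *: l x = c *: l i.
  rewrite (bigD1 i) //= eqxx mulr1n big1 ?addr0 // => x /negPf->.
  by rewrite mulr0n scale0r.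
have depf : dependency l f.
  rewrite /dependency /f.
  under eq_bigr do rewrite !scalerBl.
  rewrite !sumrB !delta.
  by rewrite scale1r lj; rewrite -!addrA -!opprD !addrA subrr.
rewrite (relation_lin d w e f (e j)); apply: idealD; last first.
  by apply/kscale_ideal/(four j).
apply: IH.
- apply: leq_trans le_n; apply: proper_card; apply/properP; split; last first.
    by exists j; rewrite inE ?ej ?nj // fj mulr1 subrr eqxx.
  apply/subsetP=> x; rewrite !inE => /andP[fx nx]; rewrite nx andbT.
  have [xj|nxj] := eqVneq x j; first by rewrite xj.
  move: fx; rewrite f0 ?mulr0 ?subr0 // !inE.
  by move: nx; rewrite !negb_or => /and3P[-> -> ->].
- move=> i wi0; rewrite e0 // f0 ?mulr0 ?subr0 //.
  have iS : i \notin S by rewrite inE wi0.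
  by rewrite !inE !negb_or; apply/and4P; split; apply: contraNneq iS => ->.
- rewrite /dependency; under eq_bigr do rewrite scalerBl -scalerA.
  by rewrite sumrB -scaler_sumr dep depf scaler0 subr0.
Qed.

(** Repetitions are allowed in [r], so that the lines of an explicit dependency need
    not be shown to be distinct. *)
Lemma relation_seq d w (r : seq (K * 'I_s)) :
  mdeg w = (2 * d).+1 -> (forall i, w i <= d)%N ->
  (forall p, p \in r -> (0 < w p.2)%N) -> \sum_(p <- r) p.1 *: l p.2 = 0 ->
  J (\sum_(p <- r) p.1 *t tmon K d (w - U_(p.2))).
Proof.
move=> dw lew wr dep; pose e i := \sum_(p <- r | p.2 == i) p.1.
have depe : dependency l e.
  rewrite /dependency -[RHS]dep /e; under eq_bigr do rewrite scaler_suml.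
  rewrite (exchange_big_dep predT) //=; apply: eq_bigr => p _.
  by rewrite (big_pred1 p.2) // => i; rewrite eq_sym.
have e0 i : w i = 0%N -> e i = 0.
  move=> wi; rewrite /e big_seq_cond big1 // => p /andP[/wr + /eqP pi].
  by rewrite pi wi.
have := relation_ideal dw lew e0 depe; congr (J _).
rewrite /relation /e.
have kscale_suml (F : Tring K s) i :
    (\sum_(p <- r | p.2 == i) p.1) *t F = \sum_(p <- r | p.2 == i) p.1 *t F.
  elim/big_rec2: _ => [|p x y _ <-]; first exact: kscale0.
  exact: kscaleDl.
under eq_bigr do rewrite kscale_suml.
rewrite (exchange_big_dep predT) //=; apply: eq_bigr => p _.
by rewrite (big_pred1 p.2) // => i; rewrite eq_sym.
Qed.

End GeneralRelations.

(** * Evaluation at the generators *)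

Section Evaluation.
Variables (K : fieldType) (s : nat) (l : 'I_s -> linear_form K).

Local Notation t i j := (@tvar K s i j).
Local Notation gens :=
  (fun G : Tring K s => type_I l G \/ type_III G \/ type_IV l G).
Local Notation J := (ideal_generated gens).
Local Notation "c *t F" := (@kscale K s c F) (at level 40).
Local Notation ell k := (l k : {mpoly K[3]}).

Lemma rees_tprod es : loopless es ->
  rees_map l (tprod K es) =
  (\prod_k ell k ^+ (size es - edeg es k))%:P * 'X^(size es).
Proof.
elim: es => [|[i j] es IH] les.
  by rewrite tprod_nil rmorph1 big1 ?mulr1 // => k _; rewrite sub0n.
have := les => /andP[/= nij les1].
rewrite tprod_cons rmorphM /= IH // rees_tvar //= exprS mulrACA -rmorphM.
congr (_%:P * _); rewrite /fgen big_mkcond -big_split; apply: eq_bigr => k _ /=.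
have := edeg_le k les1; rewrite edeg_cons !mnmDE !mnm1E /= !(eq_sym k) => le.
have [ik|nik] /= := eqVneq i k.
  have [jk|_] := eqVneq j k; first by rewrite ik jk eqxx in nij.
  by rewrite mul1r.
have [jk|njk] /= := eqVneq j k; first by rewrite mul1r.
by rewrite -exprS; congr (_ ^+ _); move: le; clear; lia.
Qed.

Lemma rees_tmon d v : valid d v ->
  rees_map l (tmon K d v) = (\prod_k ell k ^+ (d - v k))%:P * 'X^d.
Proof.
by case/(tmonP K) => es [les <- <- ->]; apply: rees_tprod.
Qed.

(** With the same [w] for several [j], only the factor [l j] depends on [j]; so a
    linear dependency of the [l j] becomes an equation between the products. *)
Lemma rees_tprod_at es j w : loopless es -> (edeg es + U_(j))%MM = w ->
  (forall k, w k <= size es)%N ->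
  rees_map l (tprod K es) =
  (ell j)%:P * ((\prod_k ell k ^+ (size es - w k))%:P * 'X^(size es)).
Proof.
move=> les <- le; rewrite rees_tprod // mulrA; congr (_ * _); rewrite -rmorphM.
congr _%:P; rewrite (bigD1 j) //= [in RHS](bigD1 j) //= mulrA -exprS; congr (_ * _).
  congr (_ ^+ _); have := le j; rewrite mnmDE mnm1E eqxx; clear; lia.
by apply: eq_bigr => k nkj; rewrite mnmDE mnm1E eq_sym (negPf nkj) addn0.
Qed.

Lemma rees_dependency3 c1 c2 c3 (j1 j2 j3 : 'I_s) (P : {poly {mpoly K[3]}}) :
  c1 *: l j1 + c2 *: l j2 + c3 *: l j3 = 0 ->
  c1%:MP%:P * ((ell j1)%:P * P) + c2%:MP%:P * ((ell j2)%:P * P)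
  + c3%:MP%:P * ((ell j3)%:P * P) = 0.
Proof.
move=> dep; rewrite !mulrA -!mulrDl -!rmorphM -!rmorphD /= !mul_mpolyC.
have -> : c1 *: ell j1 + c2 *: ell j2 + c3 *: ell j3 = 0.
  by rewrite -[RHS](congr1 (@mpoly_of_dhomog 3 K 1) dep) !linearD !linearZ.
by rewrite mul0r.
Qed.

Lemma rees_dependency4 c1 c2 c3 c4 (j1 j2 j3 j4 : 'I_s) (P : {poly {mpoly K[3]}}) :
  c1 *: l j1 + c2 *: l j2 + c3 *: l j3 + c4 *: l j4 = 0 ->
  c1%:MP%:P * ((ell j1)%:P * P) + c2%:MP%:P * ((ell j2)%:P * P)
  + c3%:MP%:P * ((ell j3)%:P * P) + c4%:MP%:P * ((ell j4)%:P * P) = 0.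
Proof.
move=> dep; rewrite !mulrA -!mulrDl -!rmorphM -!rmorphD /= !mul_mpolyC.
have -> : c1 *: ell j1 + c2 *: ell j2 + c3 *: ell j3 + c4 *: ell j4 = 0.
  by rewrite -[RHS](congr1 (@mpoly_of_dhomog 3 K 1) dep) !linearD !linearZ.
by rewrite mul0r.
Qed.

Lemma rees_sum3 c1 c2 c3 (A1 A2 A3 : Tring K s) :
  rees_map l (c1 *t A1 + c2 *t A2 + c3 *t A3) =
  c1%:MP%:P * rees_map l A1 + c2%:MP%:P * rees_map l A2
  + c3%:MP%:P * rees_map l A3.
Proof. by rewrite -!rees_kscale !rmorphD. Qed.

Lemma rees_sum4 c1 c2 c3 c4 (A1 A2 A3 A4 : Tring K s) :
  rees_map l (c1 *t A1 + c2 *t A2 + c3 *t A3 + c4 *t A4) =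
  c1%:MP%:P * rees_map l A1 + c2%:MP%:P * rees_map l A2
  + c3%:MP%:P * rees_map l A3 + c4%:MP%:P * rees_map l A4.
Proof. by rewrite -!rees_kscale !rmorphD. Qed.

Lemma tprod1 i j : t i j = tprod K [:: (i, j)].
Proof. by rewrite tprod_cons tprod_nil mulr1. Qed.

Lemma tprod2 i j i' j' : t i j * t i' j' = tprod K [:: (i, j); (i', j')].
Proof. by rewrite !tprod_cons tprod_nil mulr1. Qed.

Lemma uniq_deg (r : seq 'I_s) (k x : 'I_s) : uniq r ->
  ((\sum_(j <- r) (j == x)) + (k == x) <= 2)%N.
Proof.
move=> ur; have -> : (\sum_(j <- r) (j == x) = count_mem x r)%N.
  by rewrite -sum1_count [RHS]big_mkcond; apply: eq_bigr => j _ /=; case: eqP.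
by rewrite (count_uniq_mem _ ur); case: (x \in r); case: (k == x).
Qed.

(** The five shapes of type (IV) fit this pattern, for the five possible positions of
    [k]. *)
Lemma rees_type_IV (j1 j2 j3 j4 k : 'I_s) d1 d2 d3 d4
    (a1 b1 c1 e1 a2 b2 c2 e2 a3 b3 c3 e3 a4 b4 c4 e4 : 'I_s) :
  dependency4 l j1 j2 j3 j4 d1 d2 d3 d4 ->
  let w := (U_(j1) + U_(j2) + U_(j3) + U_(j4) + U_(k))%MM in
  [/\ a1 != b1, c1 != e1 & (U_(a1) + U_(b1) + (U_(c1) + U_(e1)) + U_(j1) = w)%MM] ->
  [/\ a2 != b2, c2 != e2 & (U_(a2) + U_(b2) + (U_(c2) + U_(e2)) + U_(j2) = w)%MM] ->
  [/\ a3 != b3, c3 != e3 & (U_(a3) + U_(b3) + (U_(c3) + U_(e3)) + U_(j3) = w)%MM] ->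
  [/\ a4 != b4, c4 != e4 & (U_(a4) + U_(b4) + (U_(c4) + U_(e4)) + U_(j4) = w)%MM] ->
  rees_map l (d1 *t (t a1 b1 * t c1 e1) + d2 *t (t a2 b2 * t c2 e2)
    + d3 *t (t a3 b3 * t c3 e3) + d4 *t (t a4 b4 * t c4 e4)) = 0.
Proof.
case=> lt12 lt23 lt34 _ dep w H1 H2 H3 H4.
have w2 x : (w x <= 2)%N.
  have u4 : uniq [:: j1; j2; j3; j4].
    apply: (@sorted_uniq _ (fun x y : 'I_s => (x < y)%N)) => /=; last by rewrite lt12 lt23 lt34.
      by move=> y z u; apply: ltn_trans.
    by move=> y; rewrite ltnn.
  have := uniq_deg k x u4; rewrite !big_cons big_nil /w !mnmDE !mnm1E.
  by rewrite addn0 !addnA.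
have T j a b c e : [/\ a != b, c != e & (U_(a) + U_(b) + (U_(c) + U_(e)) + U_(j) = w)%MM] ->
    rees_map l (t a b * t c e) = (ell j)%:P * ((\prod_k ell k ^+ (2 - w k))%:P * 'X^2).
  case=> nab nce wE; rewrite tprod2; apply: rees_tprod_at => //=; first by rewrite nab nce.
  by rewrite !edeg_cons edeg_nil addm0.
rewrite rees_sum4.
rewrite (T _ _ _ _ _ H1) (T _ _ _ _ _ H2) (T _ _ _ _ _ H3) (T _ _ _ _ _ H4).
exact: rees_dependency4.
Qed.

Lemma gens_kernel G : gens G -> rees_map l G = 0.
Proof.
case=> [|[]].
- case=> i1 i2 i3 c1 c2 c3 /andP[lt12 lt23] _ _ dep.
  have n12 : i1 != i2 by rewrite neq_ltn lt12.
  have n23 : i2 != i3 by rewrite neq_ltn lt23.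
  have n13 : i1 != i3 by rewrite neq_ltn (ltn_trans lt12 lt23).
  pose w := (U_(i1) + U_(i2) + U_(i3))%MM.
  have w1 k : (w k <= 1)%N.
    have u3 : uniq [:: i1; i2; i3] by rewrite /= !inE negb_or n12 n13 n23.
    have := count_uniq_mem k u3; rewrite /= /w !mnmDE !mnm1E addn0 addnA => ->.
    by case: (_ \in _).
  have T j a b : a != b -> (U_(a) + U_(b) + U_(j))%MM = w ->
    rees_map l (t a b) = (ell j)%:P * ((\prod_k ell k ^+ (1 - w k))%:P * 'X^1).
    move=> nab wE; rewrite tprod1; apply: rees_tprod_at => //=; first by rewrite nab.
    by rewrite edeg_cons edeg_nil addm0.
  rewrite rees_sum3.
  have E1 : (U_(i2) + U_(i3) + U_(i1))%MM = w.
    by rewrite /w; apply/mnmP=> x; rewrite !mnmDE; clear; lia.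
  have E2 : (U_(i1) + U_(i3) + U_(i2))%MM = w.
    by rewrite /w; apply/mnmP=> x; rewrite !mnmDE; clear; lia.
  rewrite (T _ _ _ n23 E1) (T _ _ _ n13 E2) (T _ _ _ n12 (erefl w)).
  exact: rees_dependency3.
- have swap (a b c d a' b' c' d' : 'I_s) : a != b -> c != d -> a' != b' -> c' != d' ->
      (U_(a) + U_(b) + (U_(c) + U_(d)))%MM = (U_(a') + U_(b') + (U_(c') + U_(d')))%MM ->
      rees_map l (t a b * t c d - t a' b' * t c' d') = 0.
    move=> n1 n2 n3 n4 dE; rewrite !tprod2 rmorphB /= !rees_tprod /= ?n1 ?n2 ?n3 ?n4 //.
    by rewrite !edeg_cons edeg_nil !addm0 /= dE subrr.
  have neq (a b : 'I_s) : (a < b)%N -> a != b by rewrite neq_ltn => ->.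
  case=> a b c d ab bc cd; apply: swap; rewrite ?neq //.
  + exact: ltn_trans bc.
  + exact: ltn_trans cd.
  + by apply/mnmP=> x; rewrite !mnmDE; clear; lia.
  + by apply: ltn_trans cd; apply: ltn_trans bc.
  + by apply/mnmP=> x; rewrite !mnmDE; clear; lia.
- have neqs (j1 j2 j3 j4 : 'I_s) d1 d2 d3 d4 : dependency4 l j1 j2 j3 j4 d1 d2 d3 d4 ->
      [/\ j1 != j2, j1 != j3, j1 != j4 & [/\ j2 != j3, j2 != j4 & j3 != j4]].
    case=> lt12 lt23 lt34 _ _; rewrite !neq_ltn lt12 lt23 lt34.
    rewrite (ltn_trans lt12 lt23) (ltn_trans lt23 lt34).
    by rewrite (ltn_trans (ltn_trans lt12 lt23) lt34).
  have AC (x y : 'X_{1..s}) : x =1 y -> x = y by move/mnmP.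
  case=> j1 j2 j3 j4 d1 d2 d3 d4 => [dep|dep|dep|dep|k dep k_out];
    have [n12 n13 n14 [n23 n24 n34]] := neqs _ _ _ _ _ _ _ _ dep.
  + by apply: (rees_type_IV (k := j1) dep); split=> //;
      apply: AC => x; rewrite !mnmDE; clear; lia.
  + by apply: (rees_type_IV (k := j2) dep); split=> //;
      apply: AC => x; rewrite !mnmDE; clear; lia.
  + by apply: (rees_type_IV (k := j3) dep); split=> //;
      apply: AC => x; rewrite !mnmDE; clear; lia.
  + by apply: (rees_type_IV (k := j4) dep); split=> //;
      apply: AC => x; rewrite !mnmDE; clear; lia.
  + move: k_out; rewrite !inE !negb_or => /and4P[k1 k2 k3 k4].
    by apply: (rees_type_IV (k := k) dep); split=> //;
      rewrite 1?eq_sym //; apply: AC => x; rewrite !mnmDE; clear; lia.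
Qed.

Lemma ideal_kernel F : J F -> rees_map l F = 0.
Proof.
move=> [n [a [g [Gg ->]]]]; rewrite rmorph_sum big1 // => i _.
by rewrite rmorphM /= (gens_kernel (Gg i)) mulr0.
Qed.

Lemma cong_rees F G : cong gens F G -> rees_map l F = rees_map l G.
Proof. by move/ideal_kernel; rewrite rmorphB => /subr0_eq. Qed.
End Evaluation.

(** * Orders of vanishing along a curve *)

Section Curves.
Variables (K : fieldType) (s : nat) (l : 'I_s -> linear_form K).
Hypothesis arrA : line_arrangement l.
Local Notation L i := (lrow (l i)).

Definition curve_order n i (M : nat) (j : 'I_s) : nat :=
  if j == n then M else nat_of_bool (L j <= L n + L i)%MS.

(** The vector [w0] represents the common point of the two lines; the other two are
    directions in which one of the forms grows while the other one stays zero. *)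
Lemma dual_vectors (n i : 'I_s) : n != i -> exists w0 w1 w2 : 'cV[K]_3,
  [/\ w0 != 0, L n *m w0 = 0 & L i *m w0 = 0] /\
  [/\ L n *m w1 = 0, L i *m w1 = 1%:M, L n *m w2 = 1%:M & L i *m w2 = 0].
Proof.
move=> nni; pose C := col_mx (L n) (L i).
have rkC : \rank C = 2 by rewrite -addsmxE rank_pair.
have fC : row_free C by rewrite /row_free rkC.
have coker0 : cokermx C != 0.
  by rewrite -mxrank_eq0 mxrank_coker rkC.
have [a a0] : exists a, col a (cokermx C) != 0.
  apply/existsP; apply: contraNT coker0 => /existsPn c0; apply/eqP/matrixP=> x y.
  by have := c0 y; rewrite negbK => /eqP/colP/(_ x); rewrite !mxE.
have [Ln0 Li0] : L n *m col a (cokermx C) = 0 /\ L i *m col a (cokermx C) = 0.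
  have : C *m col a (cokermx C) = 0 by rewrite colE mulmxA mulmx_coker mul0mx.
  by rewrite mul_col_mx -[0](@col_mx0 _ 1 1) => /eq_col_mx.
have := mulmxVp fC; rewrite -[pinvmx C]hsubmxK mul_col_row.
rewrite (scalar_mx_block 1 1 1) => /eq_block_mx[e1 e2 e3 e4].
by exists (col a (cokermx C)), (rsubmx (pinvmx C)), (lsubmx (pinvmx C)).
Qed.

(** The curve [w0 + w1 'X + w2 'X^M] passes through the common point of [l n] and
    [l i] and has contact of order [M] with [l n]. The other lines through that point
    have order 1, the remaining ones order 0. For large [M], the order along the curve
    compares lexicographically the order along [l n] and the order at the point. *)
Lemma curve_through (n i : 'I_s) M : n != i -> (1 < M)%N ->
  exists ev : {rmorphism {mpoly K[3]} -> {poly K}},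
    (forall c, ev c%:MP = c%:P) /\
    forall j, exists2 g : {poly K}, g.[0] != 0 &
      ev (l j) = 'X^(curve_order n i M j) * g.
Proof.
move=> nni M1; have [w0 [w1 [w2 [[w00 n0 i0] [n1 i1 n2 i2]]]]] := dual_vectors nni.
pose h (a : 'I_3) : {poly K} := (w0 a 0)%:P + (w1 a 0)%:P * 'X + (w2 a 0)%:P * 'X^M.
pose ev : {rmorphism {mpoly K[3]} -> {poly K}} := mmap (@polyC K) h.
exists ev; split=> [c|j]; first exact: mmapC.
pose v (w : 'cV[K]_3) := (L j *m w) 0 0.
have evE : ev (l j) = (v w0)%:P + (v w1)%:P * 'X + (v w2)%:P * 'X^M.
  rewrite linear_formE rmorph_sum /v !mxE !rmorph_sum !mulr_suml -!big_split /=.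
  apply: eq_bigr => a _; rewrite mmapZ mmapX mmap1U /h !mulrDr !mulrA !rmorphM.
  by [].
have horner0 (p : {poly K}) (c : K) N : (0 < N)%N -> (p * 'X^N + c%:P).[0] = c.
  by move=> N0; rewrite !hornerE expr0n gtn_eqF // mulr0 add0r.
rewrite evE /curve_order; have [jn|njn] := eqVneq j n.
  exists 1; first by rewrite hornerE oner_neq0.
  by rewrite /v jn n0 n1 n2 !mxE /= ?mulr1n ?mulr0n !polyC0 mul0r !add0r mul1r mulr1.
have [j_in|j_out] := boolP (L j <= L n + L i)%MS.
  have [a [b lj]] := span_pair_coefs j_in.
  have vE w : v w = a * (L n *m w) 0 0 + b * (L i *m w) 0 0.
    by rewrite /v lj linearD !linearZ /= mulmxDl -!scalemxAl !mxE.
  exists (a%:P * 'X^(M.-1) + b%:P).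
    rewrite horner0 ?ltn_predRL //; apply: contraNneq (njn) => b0.
    have : 1 *: l j + (- a) *: l n = 0 by rewrite scale1r lj b0 scale0r addr0 scaleNr subrr.
    by case/(lines_indep arrA njn) => /eqP; rewrite oner_eq0.
  rewrite !vE n0 n1 n2 i0 i1 i2 !mxE /= ?mulr1n ?mulr0n !mulr0 !mulr1 !addr0 !add0r.
  rewrite -{1}(ltn_predK M1) exprS. ring.
exists ((v w2)%:P * 'X^(M.-1) * 'X + (v w1)%:P * 'X + (v w0)%:P).
  rewrite !hornerE ?mulr0 ?add0r; apply: contraNneq w00 => v0.
  have j0 : L j *m w0 = 0 by apply/matrixP=> x y; rewrite !ord1 [RHS]mxE.
  have : (1%:M <= kermx w0)%MS.
    apply: submx_trans (span_triple arrA _ nni j_out) _.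
    by rewrite !addsmx_sub !sub_kermx n0 i0 j0 eqxx.
  by move/sub_kermxP; rewrite mul1mx => /eqP.
by rewrite expr0 mul1r -{1}(ltn_predK M1) exprS; ring.
Qed.

End Curves.

(** * Leading terms *)

Lemma polyC_collect (R : comNzRingType) (c a b : R) d :
  c%:P * (a%:P * 'X^d) + b%:P * 'X^d = (c * a + b)%:P * 'X^d.
Proof. by rewrite mulrA -mulrDl polyCD polyCM. Qed.

Lemma polyC_mulXn_eq0 (R : comNzRingType) (a : R) d : a%:P * 'X^d = 0 -> a = 0.
Proof. by move/(congr1 (fun p : {poly R} => p`_d)); rewrite coefCM coefXn eqxx mulr1 coef0. Qed.

Section Independence.
Variables (K : fieldType) (s : nat) (l : 'I_s -> linear_form K).
Hypothesis arrA : line_arrangement l.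

Local Notation gens :=
  (fun G : Tring K s => type_I l G \/ type_III G \/ type_IV l G).
Local Notation J := (ideal_generated gens).
Local Notation "x === y" := (cong gens x y) (at level 70).
Local Notation "c *t F" := (@kscale K s c F) (at level 40).
Local Notation ell k := (l k : {mpoly K[3]}).
Implicit Types (X Y : pred 'X_{1..s}) (v w : 'X_{1..s}) (u y : Tring K s).

Definition tspan d X u := exists2 r : seq (K * 'X_{1..s}),
  all (fun p => valid d p.2 && X p.2) r & u = \sum_(p <- r) p.1 *t tmon K d p.2.

Lemma tspan0 d X : tspan d X 0.
Proof. by exists [::]; rewrite ?big_nil. Qed.

Lemma tspanD d X u y : tspan d X u -> tspan d X y -> tspan d X (u + y).
Proof.
move=> [r Xr ->] [r' Xr' ->]; exists (r ++ r'); rewrite ?big_cat //.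
by rewrite all_cat Xr.
Qed.

Lemma tspanZ d X c u : tspan d X u -> tspan d X (c *t u).
Proof.
move=> [r Xr ->]; exists [seq (c * p.1, p.2) | p <- r]; first by rewrite all_map.
by rewrite big_map kscale_sumr; apply: eq_bigr => p _; rewrite kscaleA.
Qed.

Lemma tspan_tmon d X v : valid d v -> X v -> tspan d X (tmon K d v).
Proof.
move=> vv Xv; exists [:: (1, v)]; rewrite /= ?vv ?Xv //.
by rewrite big_seq1 kscale1.
Qed.

Definition eval_inj d X := forall u, tspan d X u -> rees_map l u = 0 -> J u.

Lemma eval_inj_sub d X Y : (forall v, valid d v -> X v -> Y v) ->
  eval_inj d Y -> eval_inj d X.
Proof.
move=> XY injY u [r Xr ->]; apply: injY; exists r => //.
by apply: sub_all Xr => p /andP[vp Xp]; rewrite vp XY.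
Qed.

Section LeadingTerm.
Variables (n i : 'I_s) (M : nat).
Hypotheses (nni : n != i) (M_gt1 : (1 < M)%N).

Definition weight v := (\sum_k curve_order l n i M k * v k)%N.

(** Along the curve, [tmon d v] vanishes to order [C - weight v] with [C] independent
    of [v]. So the term of [v0] has strictly the smallest order. *)
Lemma leading_coef_eq0 d Y v0 c y :
  valid d v0 -> tspan d Y y ->
  (forall v, valid d v -> Y v -> weight v < weight v0)%N ->
  rees_map l (c *t tmon K d v0 + y) = 0 -> c = 0.
Proof.
move=> vv0 [r Yr ->] wlt.
have [ev [evC evl]] := curve_through arrA nni M_gt1.
pose prodl v := \prod_k ell k ^+ (d - v k).
pose ord v := (\sum_k curve_order l n i M k * (d - v k))%N.
have ordE v : valid d v -> (ord v + weight v = \sum_k curve_order l n i M k * d)%N.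
  case/validP=> _ lev; rewrite /ord /weight -big_split /=.
  by apply: eq_bigr => k _; rewrite -mulnDr subnK.
have evP v : exists2 g : {poly K}, g.[0] != 0 & ev (prodl v) = 'X^(ord v) * g.
  rewrite /prodl /ord; elim: (index_enum _) => [|k ks [g g0 gE]].
    exists 1; first by rewrite hornerE oner_neq0.
    by rewrite !big_nil rmorph1 mulr1.
  have [h h0 hE] := evl k; exists (h ^+ (d - v k) * g).
    by rewrite hornerM horner_exp mulf_neq0 // expf_neq0.
  by rewrite !big_cons rmorphM rmorphXn /= hE gE exprMn exprD exprM mulrACA.
have [H HE] : exists H : {poly K},
    ev (\sum_(p <- r) p.1%:MP * prodl p.2) = 'X^((ord v0).+1) * H.
  elim: r Yr => [|p r IH] /=; first by exists 0; rewrite big_nil rmorph0 mulr0.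
  case/andP=> /andP[vp Yp] /IH[H HE]; have [g _ gE] := evP p.2.
  have lt : (ord v0 < ord p.2)%N.
    have := wlt _ vp Yp; have := ordE _ vp; have := ordE _ vv0; clear; lia.
  exists (p.1%:P * 'X^(ord p.2 - (ord v0).+1) * g + H).
  rewrite big_cons rmorphD rmorphM /= evC gE HE.
  by rewrite -{1}(subnKC lt) exprD mulrDr -mulrA mulrCA !mulrA.
have sumE : rees_map l (\sum_(p <- r) p.1 *t tmon K d p.2) =
    (\sum_(p <- r) p.1%:MP * prodl p.2)%:P * 'X^d.
  elim: r Yr {H HE} => [|p r IH] /=; first by rewrite !big_nil rmorph0 mul0r.
  case/andP=> /andP[vp _] /IH IH1; rewrite !big_cons rmorphD /= IH1 rees_kscale.
  rewrite (rees_tmon l vp) -/(prodl p.2) polyC_collect.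
  reflexivity.
rewrite rmorphD /= sumE rees_kscale rees_tmon // polyC_collect.
move/polyC_mulXn_eq0/(congr1 ev); rewrite rmorph0 rmorphD rmorphM /= evC HE.
have [g g0 ->] := evP v0; rewrite exprSr => /eqP.
have -> : c%:P * ('X^(ord v0) * g) + 'X^(ord v0) * 'X * H
  = 'X^(ord v0) * (c%:P * g + 'X * H) by rewrite mulrDr mulrCA -['X^_ * 'X * H]mulrA.
rewrite mulf_eq0 expf_eq0 polyX_eq0 andbF /= => /eqP/(congr1 (horner^~ 0)).
rewrite !hornerE ?mul0r ?addr0 => /eqP; rewrite mulf_eq0 (negPf g0) orbF.
by move/eqP.
Qed.

(** An element of the span of [X] is congruent to a multiple of a single monomial
    outside [Y], plus an element of the span of [Y]; the evaluation along the curve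
    forces the multiple to be zero. *)
Lemma eval_inj_step d X Y :
  eval_inj d Y ->
  (forall v v0, valid d v -> valid d v0 -> X v -> X v0 -> ~~ Y v -> ~~ Y v0 ->
     exists c y, tspan d Y y /\ tmon K d v === c *t tmon K d v0 + y) ->
  (forall v v0, valid d v -> valid d v0 -> Y v -> X v0 -> ~~ Y v0 ->
     weight v < weight v0)%N ->
  eval_inj d X.
Proof.
move=> injY prop lead u [r Xr ->] ker.
have [/hasP[[c0 v0] r0 nYv0]|/hasPn YP] := boolP (has (fun p => ~~ Y p.2) r); last first.
  apply: injY => //; exists r => //; apply/allP=> p pr.
  by have := allP Xr p pr => /andP[-> _]; have := YP p pr; rewrite negbK.
have /andP[/= vv0 Xv0] := allP Xr _ r0.
have [c [y [Yy cE]]] : exists c y, tspan d Y y /\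
    \sum_(p <- r) p.1 *t tmon K d p.2 === c *t tmon K d v0 + y.
  elim: r Xr {ker r0} => [_|p r IH] /=.
    exists 0, 0; split; first exact: tspan0.
    by rewrite big_nil kscale0 addr0; apply: cong_refl.
  case/andP=> /andP[vp Xp] /IH[c [y [Yy cE]]]; rewrite big_cons.
  have [c' [y' [Yy' cE']]] : exists c y, tspan d Y y /\
      tmon K d p.2 === c *t tmon K d v0 + y.
    have [Yp|nYp] := boolP (Y p.2); last exact: prop.
    exists 0, (tmon K d p.2); split; first exact: tspan_tmon.
    by rewrite kscale0 add0r; apply: cong_refl.
  exists (p.1 * c' + c), (p.1 *t y' + y); split.
    by apply: tspanD => //; apply: tspanZ.
  rewrite kscaleDl addrACA; apply: congD => //.
  have -> : (p.1 * c') *t tmon K d v0 + p.1 *t y' = p.1 *t (c' *t tmon K d v0 + y').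
    by rewrite -kscaleA !kscaleE mulrDr.
  exact: kscale_cong.
have c_0 : c = 0.
  apply: (leading_coef_eq0 vv0 Yy) => [v vv Yv|]; first exact: lead.
  by rewrite -(cong_rees cE).
move: cE; rewrite c_0 kscale0 add0r => cE; apply: (cong_ideal cE).
by apply: (injY y Yy); rewrite -(cong_rees cE).
Qed.

End LeadingTerm.
End Independence.

(** * Induction over strata of monomials *)

Lemma big_seq4 (V : nmodType) (T : Type) (F : T -> V) (a b c d : T) :
  \sum_(x <- [:: a; b; c; d]) F x = F a + F b + F c + F d.
Proof. by rewrite !big_cons big_nil addr0 !addrA. Qed.

Section Strata.
Variables (K : fieldType) (s : nat) (l : 'I_s -> linear_form K).
Hypothesis arrA : line_arrangement l.

Local Notation gens :=
  (fun G : Tring K s => type_I l G \/ type_III G \/ type_IV l G).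
Local Notation J := (ideal_generated gens).
Local Notation "x === y" := (cong gens x y) (at level 70).
Local Notation "c *t F" := (@kscale K s c F) (at level 40).
Local Notation L i := (lrow (l i)).
Implicit Types (v w : 'X_{1..s}) (u y : Tring K s) (A E S : {set 'I_s}).

Definition supported A v := [forall j, (j \notin A) ==> (v j == 0%N)].

Lemma supportedP A v :
  reflect (forall j, j \notin A -> v j = 0%N) (supported A v).
Proof.
by apply: (iffP forall_inP) => h j jA; apply/eqP/h.
Qed.

Lemma supported_sub A E v : A \subset E -> supported A v -> supported E v.
Proof.
move=> /subsetP AE /supportedP Av; apply/supportedP=> j jE.
by apply: Av; apply: contraNN jE; apply: AE.
Qed.

Lemma mdeg_supported A v : supported A v -> mdeg v = (\sum_(j in A) v j)%N.
Proof.
move=> /supportedP Av; rewrite mdegE (bigID (mem A)) /= [X in (_ + X)%N]big1 ?addn0 //.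
Qed.

Lemma sum_lt_witness A v v0 j : j \in A -> (v0 j < v j)%N ->
  (\sum_(x in A) v x = \sum_(x in A) v0 x)%N ->
  exists2 j', j' \in A & (v j' < v0 j')%N.
Proof.
move=> jA lt eqs.
have [/existsP[j' /andP[j'A lt']]|/existsPn ge] :=
  boolP [exists j', (j' \in A) && (v j' < v0 j')%N]; first by exists j'.
have le : (\sum_(x in A | x != j) v0 x <= \sum_(x in A | x != j) v x)%N.
  by apply: leq_sum => x /andP[xA _]; have := ge x; rewrite xA /= -leqNgt.
move: eqs; rewrite (bigD1 j jA) [RHS](bigD1 j jA) /= => eqs.
by have := leq_add lt le; rewrite addSn eqs ltnn.
Qed.

Lemma sum_mnm1 A j : (\sum_(x in A) (j == x) = (j \in A))%N.
Proof.
have [jA|jA] := boolP (j \in A).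
  by rewrite (bigD1 j jA) /= eqxx big1 // => x /andP[_]; rewrite eq_sym => /negPf->.
by rewrite big1 // => x xA; have [jx|//] := eqVneq j x; rewrite jx xA in jA.
Qed.

Lemma sum_sub1 A w x : (0 < w x)%N ->
  (\sum_(z in A) w z = \sum_(z in A) (w - U_(x))%MM z + (x \in A))%N.
Proof.
move=> wx; rewrite -sum_mnm1 -big_split /=; apply: eq_bigr => z _.
by rewrite mnmBE mnm1E subnK //; case: eqVneq => // <-.
Qed.

Lemma valid_sub1 d w i : mdeg w = (2 * d).+1 -> (forall j, w j <= d)%N ->
  (0 < w i)%N -> valid d (w - U_(i))%MM.
Proof.
move=> dw lew wi; apply/validP; split; first by rewrite mdegB1 // dw.
by move=> j; rewrite mnmBE; apply: leq_trans (leq_subr _ _) (lew j).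
Qed.

Section OneStep.
Variables (d k a : nat) (n i : 'I_s) (E S : {set 'I_s}).
Hypotheses (nE : n \notin E) (SE : S \subset E) (iS : i \in S).

(** A form in the span of [l n] and [l i] defines a line through the point where
    these two meet. *)
Definition pencil := [set j in S | (L j <= L n + L i)%MS].

(** The top layer is [v n = k.+1]. In it, [S] contains the lines that are still
    allowed, and [b] bounds the total degree in the pencil. *)
Definition stratum b v := supported (n |: E) v && ((v n <= k)%N ||
  [&& v n == k.+1, supported (n |: S) v & (\sum_(j in pencil) v j <= b)%N]).

Let nS : n \notin S. Proof. by apply: contraNN nE; apply: (subsetP SE). Qed.
Let nni : n != i. Proof. by apply: contraNneq nS => ->. Qed.
Let pencilS : pencil \subset S. Proof. by apply/subsetP=> j; rewrite inE => /andP[]. Qed.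
Let n_neq j : j \in S -> n != j. Proof. by move=> jS; apply: contraNneq nS => ->. Qed.

Lemma top_stratum v : stratum a.+1 v -> ~~ stratum a v ->
  [/\ v n = k.+1, supported (n |: S) v & (\sum_(j in pencil) v j = a.+1)%N].
Proof.
rewrite /stratum => /andP[-> /=]; rewrite negb_or => /orP[-> //|].
case/and3P=> /eqP-> -> le /=; rewrite eqxx /= => /andP[_]; rewrite -ltnNge => lt.
by split=> //; apply/eqP; rewrite eqn_leq le lt.
Qed.

Lemma sum_outside v : supported (n |: S) v ->
  (mdeg v = v n + (\sum_(j in pencil) v j + \sum_(j in S :\: pencil) v j))%N.
Proof.
move=> /mdeg_supported ->; rewrite big_setU1 //=; congr (_ + _)%N.
by rewrite (big_setID pencil) (setIidPr pencilS).
Qed.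

(** The multiplier [2 d + 2] exceeds every degree that the lines other than [l n] can
    contribute, which makes the weight lexicographic. *)
Lemma weightE v : supported (n |: S) v ->
  weight l n i (2 * d).+2 v = ((2 * d).+2 * v n + \sum_(j in pencil) v j)%N.
Proof.
move=> /supportedP Sv; rewrite /weight (bigD1 n) //= {1}/curve_order eqxx.
congr (_ + _)%N; rewrite big_mkcond [RHS]big_mkcond; apply: eq_bigr => j _.
rewrite /curve_order inE; have [->|njn] /= := eqVneq j n; first by rewrite (negPf nS).
have [jS|jS] /= := boolP (j \in S).
  by case: (L j <= L n + L i)%MS; rewrite ?mul1n ?mul0n.
by rewrite Sv ?muln0 // !inE negb_or njn.
Qed.

Lemma weight_le v : mdeg v = (2 * d)%N ->
  (weight l n i (2 * d).+2 v <= (2 * d).+2 * v n + 2 * d)%N.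
Proof.
move=> dv; rewrite /weight (bigD1 n) //= {1}/curve_order eqxx leq_add2l -dv.
rewrite mdegE [leqRHS](bigD1 n) //= -[leqLHS]add0n; apply: leq_add => //.
apply: leq_sum => j njn; rewrite /curve_order (negPf njn).
by case: (L j <= L n + L i)%MS; rewrite ?mul1n.
Qed.

Lemma pencil_span i' j : i' \in pencil -> j \in pencil ->
  (L j <= L n + L i')%MS.
Proof.
rewrite !inE => /andP[i'S i'_in] /andP[jS j_in].
apply: submx_trans j_in _; rewrite addsmx_sub addsmxSl /=.
by apply: (span_pair arrA nni); rewrite 1?eq_sym ?n_neq.
Qed.

(** Inside the pencil, [l n] and [l j] already span [l j']. Outside it, [l n], [l j] and
    a line [i'] of the pencil are not concurrent, hence span all the linear forms. *)
Lemma exchange_coefs i' j j' : i' \in pencil -> j \in S -> j' \in S ->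
  (j \in pencil) = (j' \in pencil) ->
  exists al be ga, l j' = al *: l n + be *: l i' + ga *: l j /\
    (j \in pencil -> be = 0).
Proof.
move=> i'q jS j'S same; have [jq|jq] := boolP (j \in pencil).
  have j'q : j' \in pencil by rewrite -same.
  have [al [ga ->]] := span_pair_coefs (pencil_span jq j'q).
  by exists al, 0, ga; rewrite scale0r addr0.
have i'S : i' \in S := subsetP pencilS i' i'q.
have j_out : ~~ (L j <= L n + L i')%MS.
  apply: contraNN jq => j_in; rewrite inE jS /=.
  apply: submx_trans j_in _; rewrite addsmx_sub addsmxSl /=.
  by move: i'q; rewrite inE => /andP[].
have [al [be [ga E1]]] := span_triple_coefs (span_triple arrA (L j') (n_neq i'S) j_out).
by exists al, be, ga.
Qed.

(** Induction on the distance of [v] to [v0]. A unit of degree moves from a line [j]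
    with [v0 j < v j] to a line [j'] with [v j' < v0 j'] in the same group, by the
    relation for [w = v + U_(j')]. In it the term of [n] has a smaller exponent at
    [n]; the term of the pencil line [i'] occurs only when [j], [j'] lie outside the
    pencil, and then it has a smaller degree in the pencil. *)
Lemma top_stratum_proportional v v0 : valid d v -> valid d v0 ->
  stratum a.+1 v -> stratum a.+1 v0 -> ~~ stratum a v -> ~~ stratum a v0 ->
  exists c y, tspan d (stratum a) y /\ tmon K d v === c *t tmon K d v0 + y.
Proof.
move=> vv vv0 Xv Xv0 Yv Yv0; have [n0 sup0 pen0] := top_stratum Xv0 Yv0.
have [N] := ubnP (\sum_j (v j - v0 j))%N; elim: N v vv Xv Yv => // N IH v vv Xv Yv.
rewrite ltnS => leN; have [nv supv penv] := top_stratum Xv Yv.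
have /validP[dv lev] := vv; have /validP[dv0 lev0] := vv0.
have [->|neq_v] := eqVneq v v0.
  exists 1, 0; split; first exact: tspan0.
  by rewrite kscale1 addr0; apply: cong_refl.
have [j lt_j] : exists j, (v0 j < v j)%N.
  have [/forallP eqv|] := boolP [forall j, v j == v0 j].
    by case/eqP: neq_v; apply/mnmP=> j; apply/eqP.
  case/forallPn=> j; rewrite neq_ltn => /orP[lt_j|]; last by exists j.
  have := @sum_lt_witness [set: 'I_s] v0 v j (in_setT j) lt_j.
  rewrite !(eq_bigl predT) => [|x|x]; try by rewrite inE.
  by rewrite -!mdegE dv dv0 => /(_ erefl)[j' _]; exists j'.
have jS : j \in S.
  have : j \in n |: S.
    by apply: contraLR lt_j => /(supportedP _ _ supv)->.
  by rewrite !inE => /predU1P[jn|//]; move: lt_j; rewrite jn nv n0 ltnn.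
have [j' [j'S same lt_j']] :
    exists j', [/\ j' \in S, (j \in pencil) = (j' \in pencil) & (v j' < v0 j')%N].
  have [jq|jq] := boolP (j \in pencil).
    case: (sum_lt_witness jq lt_j) => [|j' j'q lt']; first by rewrite penv.
    by exists j'; rewrite j'q (subsetP pencilS).
  have jD : j \in S :\: pencil by rewrite inE jq.
  case: (sum_lt_witness jD lt_j) => [|j' ]; last first.
    by rewrite inE => /andP[/negPf j'q j'S] lt'; exists j'; rewrite j'q.
  have := sum_outside supv; have := sum_outside sup0.
  by rewrite dv dv0 nv n0 penv pen0; clear; lia.
have [i' i'q vi'] : exists2 i', i' \in pencil & (0 < v i')%N.
  have : (0 < \sum_(x in pencil) v x)%N by rewrite penv.
  rewrite lt0n sum_nat_eq0 negb_forall => /existsP[x].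
  by rewrite negb_imply -lt0n => /andP[]; exists x.
have i'S : i' \in S := subsetP pencilS i' i'q.
have [al [be [ga [lj' be0]]]] := exchange_coefs i'q jS j'S same.
pose w := (v + U_(j'))%MM.
have dw : mdeg w = (2 * d).+1 by rewrite mdegD mdeg1 dv addn1.
have wE x : w x = (v x + (j' == x))%N by rewrite mnmDE mnm1E.
have lew x : (w x <= d)%N.
  rewrite wE; have [<-|_] := eqVneq j' x; last by rewrite addn0.
  by rewrite addn1; apply: leq_trans lt_j' (lev0 j').
have w_gt0 x : (0 < v x)%N -> (0 < w x)%N by rewrite wE; clear; lia.
have wn : (0 < w n)%N by apply: w_gt0; rewrite nv.
have wi' : (0 < w i')%N := w_gt0 i' vi'.
have wj : (0 < w j)%N by apply: w_gt0; apply: leq_ltn_trans lt_j.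
have wj' : (0 < w j')%N by rewrite wE eqxx addn1.
have rel : J (al *t tmon K d (w - U_(n)) + be *t tmon K d (w - U_(i'))
              + ga *t tmon K d (w - U_(j)) + (-1) *t tmon K d (w - U_(j'))).
  have := @relation_seq _ _ _ arrA d w [:: (al, n); (be, i'); (ga, j); (-1, j')] dw lew.
  rewrite !big_seq4 /=; apply.
    by move=> p; rewrite !inE => /or4P[]/eqP->.
  by rewrite -lj' scaleN1r subrr.
have vE : (w - U_(j'))%MM = v by rewrite /w addmK.
pose v1 := (w - U_(j))%MM.
have v1E x : v1 x = (v x + (j' == x) - (j == x))%N by rewrite mnmBE wE mnm1E.
have njj' : j != j' by apply: contraTneq lt_j => ->; rewrite -leqNgt ltnW.
have supw : supported (n |: S) w.
  apply/supportedP=> x xS; rewrite wE (supportedP _ _ supv) //.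
  by have [E1|//] := eqVneq j' x; move: xS; rewrite -E1 !inE j'S orbT.
have sup_sub x : supported (n |: S) (w - U_(x)).
  by apply/supportedP=> z zS; rewrite mnmBE (supportedP _ _ supw).
have subE x : supported (n |: E) (w - U_(x)).
  by apply: supported_sub (sup_sub x); apply: setUS.
have pen_w : (\sum_(x in pencil) w x = a.+1 + (j' \in pencil))%N.
  by rewrite -penv -sum_mnm1 -big_split /=; apply: eq_bigr => x _; rewrite wE.
have v1n : v1 n = k.+1.
  by rewrite v1E nv ![_ == n]eq_sym !(negPf (n_neq _)) // addn0 subn0.
have pen1 : (\sum_(x in pencil) v1 x = a.+1)%N.
  have := sum_sub1 pencil wj; rewrite pen_w same -/v1; clear; lia.
have [||||c [y [Yy cE]]] := IH v1.
- exact: valid_sub1.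
- by rewrite /stratum subE v1n eqxx sup_sub pen1 leqnn orbT.
- by rewrite /stratum subE v1n ltnn eqxx sup_sub pen1 ltnn.
- apply: leq_trans leN; rewrite (bigD1 j) //= [ltnRHS](bigD1 j) //=.
  rewrite -addSn; apply: leq_add.
    by rewrite v1E eqxx eq_sym (negPf njj'); move: lt_j; clear; lia.
  apply: leq_sum => x njx; rewrite v1E eq_sym [j == x]eq_sym (negPf njx).
  by have [->|_] := eqVneq x j'; move: lt_j'; clear; lia.
have tmonE : tmon K d v === ga *t tmon K d v1
    + (al *t tmon K d (w - U_(n)) + be *t tmon K d (w - U_(i'))).
  move: (idealMl (-1) rel); rewrite vE /cong; congr (J _).
  by rewrite !kscaleE !rmorphN1 /v1; ring.
exists (ga * c), (ga *t y + (al *t tmon K d (w - U_(n)) + be *t tmon K d (w - U_(i')))).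
split.
  apply: tspanD; first exact: tspanZ.
  apply: tspanD.
    apply/tspanZ/tspan_tmon; first exact: valid_sub1.
    by rewrite /stratum subE mnmBE mnm1E wE nv eqxx eq_sym (negPf (n_neq j'S)) addn0 subn1 leqnn.
  have [jq|jq] := boolP (j \in pencil).
    by rewrite (be0 jq) kscale0; apply: tspan0.
  apply/tspanZ/tspan_tmon; first exact: valid_sub1.
  rewrite /stratum subE sup_sub mnmBE mnm1E wE nv ![_ == n]eq_sym.
  rewrite !(negPf (n_neq _)) // addn0 subn0 eqxx /=; apply/orP; right.
  have := sum_sub1 pencil wi'; rewrite pen_w -same (negPf jq) i'q addn0 addn1.
  by case=> ->.
apply: cong_trans tmonE _; rewrite (addrA ((ga * c) *t tmon K d v0)).
apply: congD; last exact: cong_refl.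
have -> : (ga * c) *t tmon K d v0 + ga *t y = ga *t (c *t tmon K d v0 + y).
  by rewrite -kscaleA !kscaleE mulrDr.
exact: kscale_cong.
Qed.

Lemma eval_inj_stratum : eval_inj l d (stratum a) -> eval_inj l d (stratum a.+1).
Proof.
move=> injY; have M_gt1 : (1 < (2 * d).+2)%N by [].
apply: (eval_inj_step arrA nni M_gt1 injY) => [v v0|v v0 vv vv0 Yv Xv0 Yv0].
  exact: top_stratum_proportional.
have [n0 sup0 pen0] := top_stratum Xv0 Yv0.
have /validP[dv _] := vv; rewrite (weightE sup0) n0 pen0.
move: Yv; rewrite /stratum => /andP[_ /orP[le_k|/and3P[/eqP nv supv penv]]].
  by apply: leq_ltn_trans (weight_le dv) _; move: le_k; clear; nia.
by rewrite (weightE supv) nv ltn_add2l ltnS.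
Qed.

End OneStep.

(** Each step of the induction removes from [S] a whole pencil through a point of
    [l n]. For [S] empty the top layer could contain only [y_n ^ k.+1], whose degree
    is not [2 d] because [k < d]. *)
Lemma eval_inj_top d k n E S : n \notin E -> S \subset E ->
  eval_inj l d (fun v => supported (n |: E) v && (v n <= k)%N) ->
  (k < d)%N ->
  eval_inj l d (fun v => supported (n |: E) v &&
    ((v n <= k)%N || (v n == k.+1) && supported (n |: S) v)).
Proof.
move=> nE + inj_k kd.
have [m] := ubnP #|S|; elim: m S => // m IH S; rewrite ltnS => leS SE.
have [S0|[i iS]] := set_0Vmem S.
  apply: eval_inj_sub inj_k => v /validP[dv lev] /andP[-> /orP[-> //|]].
  rewrite S0 setU0 => /andP[/eqP nv /mdeg_supported].
  by rewrite big_set1 dv nv; move: kd; clear; lia.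
have inj0 : eval_inj l d (stratum k n i E S 0).
  have SS : S :\: pencil n i S \subset S by apply: subsetDl.
  apply: eval_inj_sub (IH (S :\: pencil n i S) _ (subset_trans SS SE)); last first.
    apply: leq_trans leS; apply: proper_card; apply/properP; split=> //.
    by exists i => //; rewrite !inE iS addsmxSr.
  move=> v _ /andP[-> /=] /orP[-> //|/and3P[-> supv pen0]]; rewrite orbC /=.
  apply/orP; left; apply/supportedP=> j; rewrite inE negb_or !inE => /andP[njn].
  rewrite negb_and negbK => /orP[jq|jS].
    move: pen0; rewrite leqn0 sum_nat_eq0 => /forall_inP/(_ j).
    by rewrite inE => /(_ jq)/eqP.
  by apply: (supportedP _ _ supv); rewrite !inE negb_or njn.
have inj_a a : eval_inj l d (stratum k n i E S a).
  by elim: a => // a; apply: eval_inj_stratum.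
apply: eval_inj_sub (inj_a (2 * d)%N) => v /validP[dv _] /andP[supv top].
rewrite /stratum supv /=; case/orP: top => [-> //|/andP[-> ->]] /=.
apply/orP; right; rewrite -dv mdegE.
by rewrite [leqRHS](bigID (mem (pencil n i S))) leq_addr.
Qed.

(** The lines are removed one at a time, each by lowering the bound on its
    exponent from [d] to [0]. *)
Lemma eval_inj_supported d E : (0 < d)%N -> eval_inj l d (supported E).
Proof.
move=> d_gt0; have [m] := ubnP #|E|; elim: m E => // m IH E; rewrite ltnS => leE.
have [->|[n nE]] := set_0Vmem E.
  move=> u [[|p r] /=]; first by rewrite big_nil => _ -> _; apply: ideal0.
  case/andP=> /andP[/validP[dp _] /mdeg_supported]; rewrite big_set0 dp.
  by move: d_gt0; clear; lia.
pose E' := E :\ n; have EE' : E = n |: E' by rewrite setD1K.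
have nE' : n \notin E' by rewrite !inE eqxx.
have inj_k k : (k <= d)%N ->
    eval_inj l d (fun v => supported (n |: E') v && (v n <= k)%N).
  elim: k => [_|k IHk kd].
    apply: eval_inj_sub (IH E' _); last first.
      by move: leE; rewrite EE' cardsU1 nE' add1n.
    move=> v _ /andP[/supportedP supv n0]; apply/supportedP=> j jE'.
    have [->|njn] := eqVneq j n; first by apply/eqP; rewrite -leqn0.
    by apply: supv; rewrite in_setU1 negb_or njn.
  apply: eval_inj_sub (eval_inj_top nE' (subxx E') (IHk (ltnW kd)) kd).
  move=> v _ /andP[supv]; rewrite supv andbT leq_eqVlt ltnS orbC.
  by [].
apply: eval_inj_sub (inj_k d (leqnn d)) => v /validP[_ lev] supv.
by rewrite -EE' supv lev.
Qed.
End Strata.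

(** * Equations of the special fiber *)

Section Bihomogeneity.
Variables (K : fieldType) (s : nat) (l : 'I_s -> linear_form K).

Local Notation t i j := (@tvar K s i j).
Local Notation gens :=
  (fun G : Tring K s => type_I l G \/ type_III G \/ type_IV l G).
Local Notation J := (ideal_generated gens).
Local Notation "c *t F" := (@kscale K s c F) (at level 40).

Lemma mpolyX_tprod (m : 'X_{1..npairs s}) :
  exists es, [/\ loopless es, size es = mdeg m & 'X_[m] = tprod K es].
Proof.
pose P (m : 'X_{1..npairs s}) :=
  exists es, [/\ loopless es, size es = mdeg m & 'X_[m] = tprod K es :> Tring K s].
have P0 : P 0%MM by exists [::]; rewrite mdeg0 mpolyX0 tprod_nil.
have PD m1 m2 : P m1 -> P m2 -> P (m1 + m2)%MM.
  move=> [es1 [le1 sz1 E1]] [es2 [le2 sz2 E2]]; exists (es1 ++ es2); split.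
  - by rewrite /loopless all_cat; apply/andP.
  - by rewrite size_cat sz1 sz2 mdegD.
  - by rewrite mpolyXD E1 E2 tprod_cat.
rewrite -/(P m) [m]multinomUE_id; apply: (big_ind P) => // k _.
elim: (m k) => [|e IH]; first by rewrite mulm0n.
rewrite mulmS; apply: PD IH; exists [:: pair_of k]; split.
- have lt : ((pair_of k).1 < (pair_of k).2)%N := valP (enum_val k).
  by rewrite /= neq_ltn lt.
- by rewrite mdeg1.
- by rewrite tprod_cons tprod_nil mulr1 tvar_pair_of.
Qed.

Local Notation bihom0 v F := (@bihomog K s 0 v F).

Lemma bihomogD v F G : bihom0 v F -> bihom0 v G -> bihom0 v (F + G).
Proof.
move=> [hF cF] [hG cG]; split; first exact: dhomogD.
by move=> m; rewrite mcoeffD; apply: dhomogD.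
Qed.

Lemma bihomogM v v' F G : bihom0 v F -> bihom0 v' G -> bihom0 (v + v') (F * G).
Proof.
move=> [hF cF] [hG cG]; split; first exact: dhomogM.
move=> m; rewrite mcoeffM; apply: rpred_sum => p _.
by rewrite -[0%N]/(0 + 0)%N; apply: dhomogM.
Qed.

Lemma bihomog_kscale v c F : bihom0 v F -> bihom0 v (c *t F).
Proof.
move=> hF; rewrite kscaleE -[v]add0n; apply: bihomogM hF; split.
  by rewrite -alg_mpolyC; apply/dhomogZ/dhomog1.
move=> m; rewrite mcoeffC; case: (m == 0%MM); rewrite ?mulr1 ?mulr0 ?dhomog0 //.
by rewrite -alg_mpolyC; apply/dhomogZ/dhomog1.
Qed.

Lemma gens_bihomog G : gens G -> exists v, bihom0 v G.
Proof.
have t2 i j i' j' : bihom0 2 (t i j * t i' j').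
  by apply: (@bihomogM 1 1); apply: bihomog_tvar.
case=> [|[]].
- case=> i1 i2 i3 c1 c2 c3 _ _ _ _; exists 1%N.
  by do 2?apply: bihomogD; apply/bihomog_kscale/bihomog_tvar.
- have tB F F' : bihom0 2 F -> bihom0 2 F' -> bihom0 2 (F - F').
    move=> hF hF'; apply: bihomogD => //.
    suff -> : - F' = (-1) *t F' by apply: bihomog_kscale.
    by rewrite kscaleE !rmorphN1 mulN1r.
  by case=> a b c d _ _ _; exists 2%N; apply: tB; apply: t2.
- by case=> *; exists 2%N; do 3?apply: bihomogD; apply/bihomog_kscale/t2.
Qed.

(** Bihomogeneity makes the coefficients scalars, so modulo the ideal the equation is
    a linear combination of the [tmon d v]. Degree 0 is apart: a constant equation is
    zero. *)
Lemma special_fiber_equation d F : line_arrangement l ->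
  rees_map l F = 0 -> bihom0 d F -> J F.
Proof.
move=> arrA ker [hF cF].
have [d0|d_gt0] := posnP d.
  have FE : F = (F@_0)%:MP.
    apply/mpolyP=> m; rewrite mcoeffC; have [->|m0] := eqVneq m 0%MM.
      by rewrite mulr1.
    by rewrite mulr0 (dhomog_nemf_coeff hF) // d0 mdeg_eq0.
  move: ker; rewrite FE /rees_map mmapC => /eqP; rewrite polyC_eq0 => /eqP->.
  by rewrite mpolyC0; apply: ideal0.
have coefE m : F@_m = (F@_m@_0)%:MP.
  apply/mpolyP=> m'; rewrite mcoeffC; have [->|m0] := eqVneq m' 0%MM.
    by rewrite mulr1.
  by rewrite mulr0 (dhomog_nemf_coeff (cF m)) // mdeg_eq0.
have [u Xu cu] : exists2 u, tspan d (supported [set: 'I_s]) u & cong gens F u.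
  rewrite (mpolyE F); have := dhomog_mf hF.
  elim: (msupp F) => [_|m ms IH hms].
    by exists 0; [apply: tspan0 | rewrite big_nil; apply: cong_refl].
  have [|u Xu cu] := IH; first by move=> m' m'ms; apply: hms; rewrite inE m'ms orbT.
  have dm : mdeg m = d by apply: hms; rewrite inE eqxx.
  have [es [les sz mE]] := mpolyX_tprod m.
  rewrite big_cons mE; exists (F@_m@_0 *t tmon K d (edeg es) + u).
    apply: tspanD Xu; apply/tspanZ/tspan_tmon; last first.
      by apply/supportedP=> j; rewrite inE.
    by rewrite -dm -sz; apply: valid_edeg.
  apply: congD cu; rewrite {1}coefE.
  by apply: kscale_cong; rewrite -dm -sz; apply: tprod_tmon.
apply: (cong_ideal cu); apply: (eval_inj_supported arrA d_gt0 Xu).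
by rewrite -(cong_rees cu).
Qed.
End Bihomogeneity.

Theorem theorem3p4 (K : fieldType) (s : nat) (l : 'I_s -> linear_form K)
    (charK0 : [pchar K] =i pred0)
    (arrA : line_arrangement l)
    (rankA : arrangement_rank l = 3%N) :
  forall F : Tring K s,
    special_fiber_ideal l F <->
    ideal_generated
      (fun G : Tring K s => type_I l G \/ type_III G \/ type_IV l G) F.
Proof.
move=> F; split; apply: ideal_sub => G.
  by case=> kerG [v]; apply: special_fiber_equation.
move=> gG; apply: ideal_gen; split; first exact: gens_kernel.
exact: gens_bihomog gG.
Qed.
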